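(* Let $X$ be a $\mathbb{Z}$ subshift and let $\mu$ be a $\mathbb{P}$-invariant measure of maximal entropy on $X^{\otimes\infty}$. Let $\hat\mu$ be the push-forward of $\mu$ under $\phi_\mu$. Then the measure-theoretic entropy of $\hat\mu$ with respect to the $\mathbb{Z}^\infty$-action by shifts is zero: $h(\hat\mu)=0$.
   Context: Let $\Sigma$ be a finite alphabet and $\hat\Sigma$ the set of nonempty subsets of $\Sigma$. Let $\mathbb{Z}^\infty=\bigoplus_{\mathbb{N}}\mathbb{Z}$, with standard generators $e_i$, and $F_n=[-n,n]^n\times\{0\}^\infty\subset\mathbb{Z}^\infty$, a F\o lner sequence. $\mathbb{Z}^\infty$ acts on $\Sigma^{\mathbb{Z}^\infty}$ and $\hat\Sigma^{\mathbb{Z}^\infty}$ by shifts $(\sigma_vx)_g=x_{g+v}$; a subshift is a closed shift-invariant subset (similarly for $\mathbb{Z}$). $\mathcal{L}(Y,S)=\{y_S:y\in Y\}$ for a subshift $Y$ and finite $S$. For a $\mathbb{Z}$ subshift $X$, $$X^{\otimes\infty}=\{x\in\Sigma^{\mathbb{Z}^\infty}:\forall g\in\mathbb{Z}^\infty\ \forall i\in\mathbb{N},\ x_{g+\mathbb{Z}e_i}\in X\},$$ where $x_{g+\mathbb{Z}e_i}$ is the sequence $m\mapsto x_{g+me_i}$. All measures are Borel probability measures. For a $\mathbb{Z}^\infty$ subshift $Y$, $h(Y)=\lim_n\frac1{|F_n|}\log|\mathcal{L}(Y,F_n)|$, and for a shift-invariant measure $\mu$, $h(\mu)=\lim_n\frac{1}{|F_n|}H_\mu(F_n)$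 with $H_\mu(F_n)=-\int\log\mu([x_{F_n}])\,d\mu(x)$, where $[x_F]=\{y : y_F=x_F\}$. A measure of maximal entropy on $Y$ is a shift-invariant measure $\mu$ on $Y$ with $h(\mu)=h(Y)$. $\mathbb{P}$ is the group of permutations of $\mathbb{N}$ fixing all but finitely many integers; it acts on $\mathbb{Z}^\infty$ by $(\rho(g))_i=g_{\rho(i)}$ and hence on $X^{\otimes\infty}$ by permuting coordinates of the index; a measure is $\mathbb{P}$-invariant if invariant under this action. For a shift-invariant measure $\mu$ on $X^{\otimes\infty}$ define, for $\mu$-a.e. $x$, $g\in\mathbb{Z}^\infty$, $a\in\Sigma$, the conditional probability $p_{x,g}(a)=\mu(\{z:z_g=a\}\mid z_{\{g\}^c}=x_{\{g\}^c})$, and $(\phi_\mu(x))_g=\{a\in\Sigma:p_{x,g}(a)>0\}$, which is $\mu$-a.s. a nonempty set for all $g$; so $\phi_\mu:X^{\otimes\infty}\to\hat\Sigma^{\mathbb{Z}^\infty}$ is a ($\mu$-a.e. defined) measurable shift-commuting map. *)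

(* Defs.v *)
From HB Require Import structures.
From mathcomp Require Import all_boot all_order all_algebra finmap.
From mathcomp Require Import zify monalg.
From mathcomp Require Import all_classical all_reals all_analysis.

Set Implicit Arguments.
Unset Strict Implicit.
Unset Printing Implicit Defensive.

Import Order.TTheory GRing.Theory Num.Theory.
Import numFieldNormedType.Exports.

Local Open Scope classical_set_scope.
Local Open Scope ring_scope.

(* Finite alphabets are pointed because [measurableType] requires a point in
   the space; a full shift over an empty alphabet carries no probability. *)
#[short(type="alphabetType")]
HB.structure Definition Alphabet := {T of Finite T & Pointed T}.

Definition nonempty_subset (A : finType) : Type :=
  {S : {set A} | S != finset.set0}.

HB.instance Definition _ (A : finType) := Finite.on (nonempty_subset A).

Fact setT_nonempty (A : alphabetType) : [set: A]%SET != finset.set0.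
Proof. by apply/set0Pn; exists point; rewrite finset.in_setT. Qed.

HB.instance Definition _ (A : alphabetType) :=
  isPointed.Build (nonempty_subset A) (exist _ [set: A]%SET (setT_nonempty A)).

(* The full shift A^G, with the product of the discrete topologies. *)
Definition config (G : Type) (A : alphabetType) : Type :=
  prod_topology (fun _ : G => discrete_topology A).

Definition borel_config (G : Type) (A : alphabetType) : Type :=
  g_sigma_algebraType (@open (config G A)).

HB.instance Definition _ (G : Type) (A : alphabetType) :=
  Measurable.on (borel_config G A).

Definition shift_config (G : zmodType) (A : alphabetType) (v : G)
  (x : config G A) : config G A := fun g => x (g + v).

Definition subshift (G : zmodType) (A : alphabetType) (X : set (config G A)) :=
  closed X /\ forall v, shift_config v @` X `<=` X.

(* Finitely supported functions from nat to int; [g@_i] is the coordinate i. *)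
Notation Zinf := {malg int[nat]}.

Definition gen (i : nat) : Zinf := mkmalgU i 1.

Definition tensor_infty (A : alphabetType) (X : set (config int A)) :
  set (config Zinf A) :=
  [set x | forall (g : Zinf) (i : nat), X (fun m : int => x (g + gen i *~ m))].

Definition box (n : nat) : set Zinf :=
  [set g | (forall i, (i < n)%N -> - n%:Z <= g@_i <= n%:Z) /\
           (forall i, (n <= i)%N -> g@_i = 0)].

Lemma finite_box (n : nat) : finite_set (box n).
Proof.
pose F (f : {ffun 'I_n.+1 -> 'I_n.*2.+1}) : Zinf :=
  [malg i in [fset j | j in iota 0 n]%fset => Posz (f (inord i)) - n%:Z].
apply: (@sub_finite_set _ _ (F @` setT)); last first.
  exact/finite_image/finite_finset.
move=> g [gle g0].
exists [ffun i : 'I_n.+1 => inord (absz (g@_(val i) + n%:Z))] => //.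
apply/malgP => i; rewrite mcoeffE !inE mem_iota /= add0n.
case: ltnP => [lt_in|/g0 //]; have := gle i lt_in.
have i_n : nat_of_ord (inord i : 'I_n.+1) = i by rewrite inordK // leqW.
rewrite ffunE /= i_n; set m : int := g@_i; clearbody m => le_m.
by rewrite inordK; lia.
Qed.

(* [fset_set] sends infinite sets to the empty set; see [finite_box]. *)
Definition folner (n : nat) : {fset Zinf} := fset_set (box n).

Definition language (A : alphabetType) (Y : set (config Zinf A))
    (S : {fset Zinf}) : {set {ffun S -> A}} :=
  [set w | `[< exists2 y, Y y & w = [ffun g : S => y (val g)] >]]%SET.

Section Entropy.
Context {R : realType} {A : alphabetType}.
Implicit Types (Y : set (config Zinf A))
  (mu : probability (borel_config Zinf A) R).

Definition top_entropy_seq Y (n : nat) : R :=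
  ln #|language Y (folner n)|%:R / #|` folner n|%:R.

(* [limn] is a default value on divergent sequences; the sequences below
   converge for subshifts and for shift-invariant measures. *)
Definition top_entropy Y : R := limn (top_entropy_seq Y).

Definition cylinder (F : {fset Zinf}) (x : config Zinf A) :
  set (config Zinf A) := [set y | forall g, g \in F -> y g = x g].

Definition block_entropy mu (F : {fset Zinf}) : R :=
  - \int[mu]_x ln (fine (mu (cylinder F x))).

Definition entropy_seq mu (n : nat) : R :=
  block_entropy mu (folner n) / #|` folner n|%:R.

Definition entropy mu : R := limn (entropy_seq mu).

Definition shift_invariant mu :=
  forall (v : Zinf) (B : set (borel_config Zinf A)),
    measurable B -> mu (shift_config v @^-1` B) = mu B.

Definition measure_of_maximal_entropy Y mu :=
  [/\ shift_invariant mu, mu Y = 1%E & entropy mu = top_entropy Y].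

End Entropy.

Record finitary_perm := FinitaryPerm {
  fperm :> nat -> nat;
  fperm_inv : nat -> nat;
  fpermK : cancel fperm fperm_inv;
  fperm_invK : cancel fperm_inv fperm;
  finite_fperm : finite_set [set i | fperm i <> i] }.

Definition perm_Zinf (r : finitary_perm) (g : Zinf) : Zinf :=
  [malg i in [fset fperm_inv r j | j in msupp g]%fset => g@_(r i)].

Lemma mcoeff_perm_Zinf (r : finitary_perm) (g : Zinf) (i : nat) :
  (perm_Zinf r g)@_i = g@_(r i).
Proof.
rewrite mcoeffE; case: ifPn => //= Ni; apply/esym/eqP.
rewrite mcoeff_eq0; apply: contra Ni => gi.
by apply/imfsetP; exists (r i) => //; rewrite fpermK.
Qed.

Definition perm_config (A : alphabetType) (r : finitary_perm)
  (x : config Zinf A) : config Zinf A := fun g => x (perm_Zinf r g).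

Definition perm_invariant (R : realType) (A : alphabetType)
    (mu : probability (borel_config Zinf A) R) :=
  forall (r : finitary_perm) (B : set (borel_config Zinf A)),
    measurable B -> mu (perm_config r @^-1` B) = mu B.

Definition off (g : Zinf) : Type := {h : Zinf | h != g}.

(* x |-> x_{{g}^c} *)
Definition restrict_off (A : alphabetType) (g : Zinf) (x : config Zinf A) :
  config (off g) A := fun h => x (val h).
Arguments restrict_off {A} g x.

Section Phi.
Context {R : realType} {A : alphabetType}.
Variable mu : probability (borel_config Zinf A) R.

(* [p y a] is a version of mu(z_g = a | z_{{g}^c} = y). *)
Definition is_cond_prob (g : Zinf) (p : config (off g) A -> A -> R) :=
  forall a : A,
    measurable_fun [set: borel_config (off g) A] (p ^~ a) /\
    forall B : set (borel_config (off g) A), measurable B ->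
      (\int[mu]_(x in restrict_off g @^-1` B) (p (restrict_off g x) a)%:E
       = mu (restrict_off g @^-1` B `&` [set x | x g = a]))%E.

(* Conditional probabilities, hence phi_mu, are only determined mu-a.e.;
   any measurable version is allowed. *)
Definition is_phi (phi : borel_config Zinf A ->
                         borel_config Zinf (nonempty_subset A)) :=
  exists2 p : forall g : Zinf, config (off g) A -> A -> R,
    forall g, is_cond_prob (p g) &
    {ae mu, forall x, forall g,
       val (phi x g) = [set a | 0 < p g (restrict_off g x) a]%SET}.

End Phi.

(* Main.v *)
Require Import Defs.
From mathcomp Require Import all_boot all_order all_algebra finmap.
From mathcomp Require Import zify ring lra monalg.
From mathcomp Require Import all_classical all_reals all_analysis.
From mathcomp Require Import measurable_realfun.

Set Implicit Arguments.
Unset Strict Implicit.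
Unset Printing Implicit Defensive.

Import Order.TTheory GRing.Theory Num.Theory.
Import numFieldNormedType.Exports.

Local Open Scope classical_set_scope.
Local Open Scope ring_scope.

(* Write u_g(x) for the support of the conditional law of x_g given x off g, so
   that u_0 is a function of x off 0, and let c be the infimum of H(x_0 | x_S)
   over the finite sets S not containing 0.
   Since u is equivariant, a finitary permutation fixing h moves the window
   which nearly determines u_h away from any given site g; hence u_h is nearly
   determined by finite windows avoiding g, conditioning x_g on u does not
   lower its entropy below c, and H(x_F, u_F) >= H(u_F) + |F| c.
   Conversely, fix a finite S supported on m coordinates with entries below M,
   and let key(g) count the coordinates of g divisible by M. If one of the
   blocks of m consecutive coordinates of g consists of multiples of M, then
   adding to g a nonzero element of S moved into that block lowers the key, so
   along an enumeration of F_n by increasing key the past of g contains a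
   permuted translate of S. This holds for all but a vanishing proportion of
   the g in F_n, hence H(x_F, u_F) <= |F| (c + o(1)), and H(u_F) = o(|F|). *)

(** * Entropy of finite-valued random variables *)

Section FiniteEntropy.
Context {R : realType} {d : measure_display} {T : measurableType d}.
Variable P : probability T R.

(** Measurability is asked fibre by fibre, so that finite types, their products and finite function
    types need no sigma-algebra of their own. *)
Definition fin_measurable (U : finType) (X : T -> U) :=
  forall u, measurable (X @^-1` [set u]).

Definition law (U : finType) (X : T -> U) (u : U) : R :=
  fine (P (X @^-1` [set u])).

Definition ent (U : finType) (X : T -> U) : R :=
  \sum_u - (law X u * ln (law X u)).

Lemma fin_measurable_preimage (U : finType) (X : T -> U) (D : set U) :
  fin_measurable X -> measurable (X @^-1` D).
Proof.
move=> mX; rewrite (_ : X @^-1` D = \bigcup_(u in D) X @^-1` [set u]).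
  by apply: fin_bigcup_measurable => // u _; exact: mX.
apply/seteqP; split=> [t Dt|t [u Du Xt]]; first by exists (X t).
by move: Xt; rewrite /preimage/= => ->.
Qed.

Lemma fin_measurable_comp (U V : finType) (X : T -> U) (f : U -> V) :
  fin_measurable X -> fin_measurable (f \o X).
Proof. by move=> mX v; exact: (fin_measurable_preimage (f @^-1` [set v])). Qed.

Lemma fin_measurable_pair (U V : finType) (X : T -> U) (Y : T -> V) :
  fin_measurable X -> fin_measurable Y ->
  fin_measurable (fun t => (X t, Y t)).
Proof.
move=> mX mY [u v]; rewrite (_ : _ @^-1` _ = X @^-1` [set u] `&` Y @^-1` [set v]).
  exact: measurableI.
by apply/seteqP; split=> t /= => [[]|[-> ->]].
Qed.

Lemma fin_measurable_ffun (I U : finType) (X : I -> T -> U) :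
  (forall i, fin_measurable (X i)) ->
  fin_measurable (fun t => [ffun i => X i t]).
Proof.
move=> mX f; rewrite (_ : _ @^-1` _ = \bigcap_(i in setT) X i @^-1` [set f i]).
  by apply: fin_bigcap_measurable => // i _; exact: mX.
apply/seteqP; split=> t /= => [<- i _ /=|h]; first by rewrite ffunE.
by apply/ffunP => i; rewrite ffunE; exact: h.
Qed.

Lemma fin_measurable_bool (D : set T) :
  measurable D -> fin_measurable (fun t => `[< D t >]).
Proof.
move=> mD [].
  rewrite (_ : _ @^-1` _ = D)//.
  apply/seteqP; split=> t; rewrite /preimage/=; first by move=> /asboolP.
  by move=> Dt; exact/asboolP.
rewrite (_ : _ @^-1` _ = ~` D); first exact: measurableC.
apply/seteqP; split=> t; rewrite /preimage/=; first by move=> /negbT/asboolPn.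
by move=> Dt; apply/negbTE/asboolPn.
Qed.

Lemma law_ge0 (U : finType) (X : T -> U) u : 0 <= law X u.
Proof. exact: fine_ge0. Qed.

Lemma law_le1 (U : finType) (X : T -> U) u : fin_measurable X -> law X u <= 1.
Proof.
move=> mX; rewrite -lee_fin fineK ?fin_num_measure//.
exact: probability_le1.
Qed.

Lemma law_comp (U V : finType) (X : T -> U) (f : U -> V) (v : V) :
  fin_measurable X -> law (f \o X) v = \sum_(u | f u == v) law X u.
Proof.
move=> mX; rewrite /law sum_fine; last by move=> u _; rewrite fin_num_measure.
rewrite (_ : _ @^-1` _ = \bigcup_(u in [set u | f u = v]) X @^-1` [set u]).
  rewrite measure_fin_bigcup//=.
  - rewrite fsbig_finite; last exact: finite_finset.
    congr fine; rewrite -[RHS]big_filter; apply: perm_big.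
    apply: uniq_perm; rewrite ?fset_uniq ?filter_uniq ?index_enum_uniq//.
    move=> u; rewrite in_fset_set; last exact: finite_finset.
    rewrite mem_filter mem_index_enum andbT.
    by apply/idP/eqP; rewrite inE.
  - by move=> u u' _ _ [t [/= -> ->]].
apply/seteqP; split=> [t ft|t [u fu Xt]]; first by exists (X t).
by move: Xt; rewrite /preimage/= => ->.
Qed.

Lemma sum_law (U : finType) (X : T -> U) :
  fin_measurable X -> \sum_u law X u = 1.
Proof.
move=> mX; rewrite -(eq_bigl _ _ (fun u => eqxx tt)).
rewrite -(law_comp (fun=> tt) tt mX) /law.
rewrite (_ : _ @^-1` _ = setT) ?probability_setT//.
by apply/seteqP; split.
Qed.

Lemma sum_law_comp (U V : finType) (X : T -> U) (f : U -> V) (F : V -> R) :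
  fin_measurable X ->
  \sum_v law (f \o X) v * F v = \sum_u law X u * F (f u).
Proof.
move=> mX; under eq_bigr do rewrite law_comp// mulr_suml.
rewrite [RHS](partition_big f xpredT)//=; apply: eq_bigr => v _.
by apply: eq_bigr => u /eqP->.
Qed.

Lemma sum_law_pair (U V : finType) (X : T -> U) (Y : T -> V) (v : V) :
  fin_measurable X -> fin_measurable Y ->
  \sum_u law (fun t => (X t, Y t)) (u, v) = law Y v.
Proof.
move=> mX mY; set XY := fun t => (X t, Y t).
rewrite (_ : Y = snd \o XY)// law_comp; last exact: fin_measurable_pair.
rewrite [RHS]big_mkcond [RHS](eq_bigr (fun a => if a.2 == v then law XY (a.1, a.2) else 0));
  last by case.
rewrite -(pair_bigA _ (fun u b => if b == v then law XY (u, b) else 0))/=.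
by apply: eq_bigr => u _; rewrite -big_mkcond big_pred1_eq.
Qed.

Lemma le_law_comp (U V : finType) (X : T -> U) (f : U -> V) u :
  fin_measurable X -> law X u <= law (f \o X) (f u).
Proof.
move=> mX; rewrite law_comp// (bigD1 u)//= lerDl.
by apply: sumr_ge0 => *; exact: law_ge0.
Qed.

Lemma entE (U : finType) (X : T -> U) :
  ent X = - \sum_u law X u * ln (law X u).
Proof. by rewrite /ent sumrN. Qed.

Lemma ent_comp_le (U V : finType) (X : T -> U) (f : U -> V) :
  fin_measurable X -> ent (f \o X) <= ent X.
Proof.
move=> mX; rewrite !entE lerN2 (sum_law_comp f (fun v => ln (law (f \o X) v)))//.
apply: ler_sum => u _; have := law_ge0 X u; rewrite le_eqVlt => /predU1P[<-|p0].
  by rewrite !mul0r.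
by rewrite ler_pM2l// ler_ln ?posrE ?le_law_comp// (lt_le_trans p0)// le_law_comp.
Qed.

(** Functional dependence is stated throughout as an implication between equalities. A map on values
    is recovered by choosing a preimage, with [point] as a default off the range of [X]. *)
Lemma factor_through (U V : Type) (X : T -> U) (Y : T -> V) :
  (forall t t', X t = X t' -> Y t = Y t') -> exists f, Y = f \o X.
Proof.
move=> XY; exists (fun u => Y (xget point [set t | X t = u])).
by apply/funext => t /=; apply: XY; case: xgetP => //= /(_ t).
Qed.

Lemma ent_le (U V : finType) (X : T -> U) (Y : T -> V) :
  fin_measurable X -> (forall t t', X t = X t' -> Y t = Y t') ->
  ent Y <= ent X.
Proof. by move=> mX /factor_through[f ->]; exact: ent_comp_le. Qed.

Lemma ent_eq (U V : finType) (X : T -> U) (Y : T -> V) :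
  fin_measurable X -> fin_measurable Y ->
  (forall t t', X t = X t' <-> Y t = Y t') -> ent Y = ent X.
Proof.
by move=> mX mY XY; apply/eqP; rewrite eq_le !ent_le// => t t' /XY.
Qed.

Lemma ent_const (U : finType) (X : T -> U) :
  (forall t t', X t = X t') -> ent X = 0.
Proof.
move=> Xcst; apply: big1 => u _; rewrite /law.
have [Xu|Xu] := eqVneq (X point) u.
  rewrite (_ : _ @^-1` _ = setT) ?probability_setT ?ln1 ?mulr0 ?oppr0//.
  by apply/seteqP; split => // t _; rewrite /preimage/= (Xcst t point).
rewrite (_ : _ @^-1` _ = set0) ?measure0 ?mul0r ?oppr0//.
apply/seteqP; split => // t; rewrite /preimage/= (Xcst t point) => Xu'.
by rewrite Xu' eqxx in Xu.
Qed.

(** This is ln x <= x - 1 at x = 1/p, multiplied by p. *)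
Lemma ge_ent_term (p : R) : 0 <= p -> - (p * ln p) <= 1 - p.
Proof.
rewrite le_eqVlt => /predU1P[<-|p0]; first by rewrite mul0r oppr0 addr0.
have V0 : 0 < p^-1 by rewrite invr_gt0.
have := le_ln1Dx (x := p^-1 - 1); rewrite [1 + _]addrC subrK lnV ?posrE//.
move=> /(_ _) h; rewrite -mulrN -(@ler_pM2l _ p^-1)// mulKf ?gt_eqF//.
rewrite mulrBr mulr1 mulVf ?gt_eqF//; apply: h; lra.
Qed.

(** A crude bound, each term being at most 1. It will only be weighted by the vanishing proportion
    of bad sites. *)
Lemma ent_le_card (U : finType) (X : T -> U) : ent X <= #|U|%:R.
Proof.
rewrite -sum1_card natr_sum; apply: ler_sum => u _.
have := ge_ent_term (law_ge0 X u); have := law_ge0 X u; lra.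
Qed.

Lemma ent_ge0 (U : finType) (X : T -> U) : fin_measurable X -> 0 <= ent X.
Proof.
move=> mX; apply: sumr_ge0 => u _; rewrite -mulrN mulr_ge0 ?law_ge0// oppr_ge0.
exact/ln_le0/law_le1.
Qed.

(* The inequality [ln x <= x - 1] applied at
   [x = p(u,w) p(v,w) / (p(u,v,w) p(w))]. *)
Lemma ent_submod (U V W : finType) (X : T -> U) (Y : T -> V) (Z : T -> W) :
  fin_measurable X -> fin_measurable Y -> fin_measurable Z ->
  ent (fun t => (X t, Y t, Z t)) + ent Z <=
  ent (fun t => (X t, Z t)) + ent (fun t => (Y t, Z t)).
Proof.
move=> mX mY mZ; set XYZ := fun t => (X t, Y t, Z t).
have m3 : fin_measurable XYZ by do 2 apply: fin_measurable_pair => //.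
pose fXZ (a : U * V * W) := (a.1.1, a.2).
pose fYZ (a : U * V * W) := (a.1.2, a.2).
pose fZ (a : U * V * W) := a.2.
pose pXZ := law (fun t => (X t, Z t)); pose pYZ := law (fun t => (Y t, Z t)).
pose pZ := law Z; pose p := law XYZ.
have eZ : ent Z = - \sum_a p a * ln (pZ a.2).
  by rewrite entE (sum_law_comp fZ (fun w => ln (pZ w)) m3).
have eXZ : ent (fun t => (X t, Z t)) = - \sum_a p a * ln (pXZ (fXZ a)).
  by rewrite entE (sum_law_comp fXZ (fun w => ln (pXZ w)) m3).
have eYZ : ent (fun t => (Y t, Z t)) = - \sum_a p a * ln (pYZ (fYZ a)).
  by rewrite entE (sum_law_comp fYZ (fun w => ln (pYZ w)) m3).
(* Summing over u and v leaves p(w) p(w) / p(w), which is p(w); if p(w) = 0 the quotient is 0 by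
   convention. *)
have le1 : \sum_(a : U * V * W) pXZ (fXZ a) * pYZ (fYZ a) / pZ a.2 <= 1.
  rewrite -(pair_bigA _ (fun uv w => pXZ (uv.1, w) * pYZ (uv.2, w) / pZ w))/=.
  rewrite exchange_big/= -(sum_law mZ); apply: ler_sum => w _.
  rewrite -mulr_suml.
  rewrite -(pair_bigA _ (fun u v => pXZ (u, w) * pYZ (v, w)))/=.
  under eq_bigr do rewrite -mulr_sumr.
  rewrite -mulr_suml.
  rewrite (sum_law_pair w mX mZ) (sum_law_pair w mY mZ) -/(pZ w).
  have [->|nz] := eqVneq (pZ w) 0; first by rewrite !mul0r.
  by rewrite mulfK.
rewrite eZ eXZ eYZ entE -subr_ge0.
have -> : - (\sum_a p a * ln (pXZ (fXZ a))) - (\sum_a p a * ln (pYZ (fYZ a))) -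
  (- (\sum_a p a * ln (p a)) - \sum_a p a * ln (pZ a.2)) =
  \sum_a p a * (ln (p a) + ln (pZ a.2) - ln (pXZ (fXZ a)) - ln (pYZ (fYZ a))).
  under [RHS]eq_bigr do rewrite !mulrBr mulrDr.
  by rewrite !sumrB big_split/=; ring.
apply: (@le_trans _ _ (\sum_a (p a - pXZ (fXZ a) * pYZ (fYZ a) / pZ a.2))).
  by rewrite sumrB (sum_law m3) subr_ge0.
apply: ler_sum => a _; have := law_ge0 XYZ a; rewrite -/p le_eqVlt.
case/predU1P=> [<-|p0].
  rewrite mul0r sub0r oppr_le0 divr_ge0 ?mulr_ge0 ?law_ge0//.
have xz0 : 0 < pXZ (fXZ a) := lt_le_trans p0 (le_law_comp fXZ a m3).
have yz0 : 0 < pYZ (fYZ a) := lt_le_trans p0 (le_law_comp fYZ a m3).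
have z0 : 0 < pZ a.2 := lt_le_trans p0 (le_law_comp fZ a m3).
set x := pXZ (fXZ a) * pYZ (fYZ a) / pZ a.2 / p a.
have x0 : 0 < x by rewrite !divr_gt0// mulr_gt0.
have -> : ln (p a) + ln (pZ a.2) - ln (pXZ (fXZ a)) - ln (pYZ (fYZ a)) = - ln x.
  by rewrite !lnM ?posrE ?invr_gt0 ?divr_gt0 ?mulr_gt0// !lnV ?posrE//; ring.
have -> : p a - pXZ (fXZ a) * pYZ (fYZ a) / pZ a.2 = p a * (1 - x).
  by rewrite mulrBr mulr1 /x [p a * (_ / p a)]mulrC divfK ?gt_eqF.
rewrite ler_pM2l//; have := le_ln1Dx (x := x - 1); rewrite [1 + _]addrC subrK => h.
have {}h : ln x <= x - 1 by apply: h; lra.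
lra.
Qed.

(** An explicit modulus making the entropy of an event small with its probability p. With s = sqrt
    p, the term of p is 2 s (- s ln s) <= 2 s, and the term of 1 - p is at most p <= s. *)
Lemma ent_bool_le (D : set T) : measurable D ->
  ent (fun t => `[< D t >]) <= 3 * Num.sqrt (fine (P D)).
Proof.
move=> mD; set X := fun t => `[< D t >]; have mX := fin_measurable_bool mD.
rewrite /ent big_bool/=.
have pT : law X true = fine (P D).
  by rewrite /law (_ : _ @^-1` _ = D)//; apply/seteqP; split=> t /= /asboolP.
have /eqP := sum_law mX.
rewrite big_bool/= pT addrC eq_sym -subr_eq => /eqP; rewrite -/X => pF.
have p0 : 0 <= fine (P D) by rewrite -pT law_ge0.
have p1 : fine (P D) <= 1 by rewrite -pT law_le1.
have pF0 := law_ge0 X false; have := ge_ent_term pF0.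
rewrite -pF; move: p0 p1; set p := fine (P D) => p0 p1 hF.
set s := Num.sqrt p; have s0 : 0 <= s by rewrite sqrtr_ge0.
have ps : p = s * s by rewrite -expr2 sqr_sqrtr.
have s1 : s <= 1 by rewrite -sqrtr1 ler_sqrt.
have h : - (p * ln p) <= 2 * s.
  move: s0; rewrite le_eqVlt => /predU1P[s0|s0].
    by rewrite ps -s0 !mul0r oppr0 mulr0.
  rewrite ps lnM ?posrE//; have := ge_ent_term (ltW s0) => hs.
  have : s * - (s * ln s) <= s * 1 by apply: ler_wpM2l; [exact: ltW|lra].
  lra.
have : s * s <= s * 1 by apply: ler_wpM2l.
move: hF h; rewrite ps; lra.
Qed.

End FiniteEntropy.

Ltac fmeas := repeat apply: fin_measurable_pair; assumption.

(** * Conditional entropy of finite-valued variables *)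

Section ConditionalEntropy.
Context {R : realType} {d : measure_display} {T : measurableType d}.
Variable P : probability T R.
Local Notation H := (ent P).

(** H(X | Y), defined through the chain rule so that no conditional law is involved. *)
Definition cent (U V : finType) (X : T -> U) (Y : T -> V) : R :=
  H (fun t => (X t, Y t)) - H Y.

Lemma cent_antimono (U V V' : finType) (X : T -> U) (Y : T -> V) (Y' : T -> V') :
  fin_measurable X -> fin_measurable Y -> fin_measurable Y' ->
  (forall t t', Y' t = Y' t' -> Y t = Y t') -> cent X Y' <= cent X Y.
Proof.
move=> mX mY mY' Y'Y; have := ent_submod P mX mY' mY.
have -> : H (fun t => (X t, Y' t, Y t)) = H (fun t => (X t, Y' t)).
  apply: ent_eq; [fmeas|fmeas|].
  by move=> t t'; split=> [[-> h]|[-> ->]//]; rewrite h (Y'Y _ _ h).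
have -> : H (fun t => (Y' t, Y t)) = H Y'.
  apply: ent_eq; [fmeas|fmeas|].
  by move=> t t'; split=> [h|[->]//]; rewrite h (Y'Y _ _ h).
rewrite /cent; lra.
Qed.

Lemma cent_le (U U' V : finType) (X : T -> U) (X' : T -> U') (Y : T -> V) :
  fin_measurable X -> fin_measurable Y ->
  (forall t t', X t = X t' -> Y t = Y t' -> X' t = X' t') ->
  cent X' Y <= cent X Y.
Proof.
move=> mX mY XX'; rewrite lerB//; apply: ent_le.
  exact: fin_measurable_pair.
by move=> t t' [hX hY]; rewrite (XX' _ _ hX hY) hY.
Qed.

Lemma cent_chain (U U' V : finType) (X : T -> U) (X' : T -> U') (Y : T -> V) :
  fin_measurable X -> fin_measurable X' -> fin_measurable Y ->
  cent (fun t => (X t, X' t)) Y = cent X (fun t => (X' t, Y t)) + cent X' Y.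
Proof.
move=> mX mX' mY; rewrite /cent.
have -> : H (fun t => (X t, (X' t, Y t))) = H (fun t => (X t, X' t, Y t)).
  apply: ent_eq; [fmeas|fmeas|].
  by move=> t t'; split=> [[-> -> ->]|[-> -> ->]].
by ring.
Qed.

Lemma cent_pair_le (U U' V : finType) (X : T -> U) (X' : T -> U') (Y : T -> V) :
  fin_measurable X -> fin_measurable X' -> fin_measurable Y ->
  cent (fun t => (X t, X' t)) Y <= cent X Y + cent X' Y.
Proof.
move=> mX mX' mY; rewrite cent_chain// lerD2r; apply: cent_antimono => //.
  exact: fin_measurable_pair.
by move=> t t' [].
Qed.

Lemma cent_ge0 (U V : finType) (X : T -> U) (Y : T -> V) :
  fin_measurable X -> fin_measurable Y -> 0 <= cent X Y.
Proof.
move=> mX mY; rewrite subr_ge0; apply: ent_le; first exact: fin_measurable_pair.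
by move=> t t' [].
Qed.

Lemma cent_eq0 (U V : finType) (X : T -> U) (Y : T -> V) :
  fin_measurable X -> fin_measurable Y ->
  (forall t t', Y t = Y t' -> X t = X t') -> cent X Y = 0.
Proof.
move=> mX mY YX; apply/eqP; rewrite subr_eq0; apply/eqP/ent_eq => //.
  exact: fin_measurable_pair.
by move=> t t'; split=> [h|[]//]; rewrite h (YX _ _ h).
Qed.

Lemma cent_le_ent (U V : finType) (X : T -> U) (Y : T -> V) :
  fin_measurable X -> fin_measurable Y -> cent X Y <= H X.
Proof.
(* A constant is determined by any [Y] and has zero entropy, so conditioning on it bounds all other
   conditional entropies of [X]. *)
move=> mX mY; have m1 : fin_measurable (fun _ : T => tt).
  by move=> u; rewrite (_ : _ @^-1` _ = setT)//; apply/seteqP; split=> // t _; case: u.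
have e0 : H (fun _ : T => tt) = 0 by exact: ent_const.
have := cent_antimono mX m1 mY (fun _ _ _ => erefl); rewrite /cent e0 subr0.
move/le_trans; apply; apply: ent_le => // t t' -> //.
Qed.

End ConditionalEntropy.

(** * Topology and measurability of configuration spaces *)

Section ConfigTopology.
Context {A : alphabetType}.

(** Reduces the product topology to agreement on finite sets of sites. *)
Lemma open_configP (G : Type) (O : set (config G A)) :
  open O <-> forall y, O y -> exists2 D : set G, finite_set D &
    forall z : config G A, (forall g, D g -> z g = y g) -> O z.
Proof.
split=> [oO y Oy|h].
  (* The sets containing every configuration that agrees with [y] on some finite set form a filter;
     it converges to [y] coordinatewise, so it contains every neighbourhood of [y]. *)
  pose F : set_system (config G A) := [set Q | exists2 D : set G, finite_set D &
    forall z : config G A, (forall g, D g -> z g = y g) -> Q z].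
  have FF : Filter F.
    split.
    - by exists set0.
    - move=> Q Q' [D fD QD] [D' fD' QD']; exists (D `|` D').
        by rewrite finite_setU.
      by move=> z hz; split; [apply: QD|apply: QD'] => g Dg; apply: hz; [left|right].
    - by move=> Q Q' QQ' [D fD QD]; exists D => // z /QD/QQ'.
  have Fy : F --> y.
    apply/cvg_sup => i U [V] [[W] oW <-] Wyi WU; apply: (filterS WU).
    by exists [set i] => // z /(_ i erefl) zi; rewrite /= zi.
  by apply: Fy; exact: open_nbhs_nbhs.
rewrite openE => y /h[D fD DO]; rewrite /interior.
apply: (@filterS _ _ _ (\bigcap_(g in D) [set z | z g = y g])) => //.
(* Conversely, a finite intersection of coordinate conditions is a neighbourhood, by induction on an
   enumeration of the finite set of sites. *)
suff : forall s : seq {classic G},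
    nbhs y (\bigcap_(g in [set` s]) [set z : config G A | z g = y g]).
  have /(@finite_seqP {classic G})[s ->] := fD; exact.
elim=> [|g s ihs].
  by rewrite set_nil bigcap_set0; exact: filterT.
suff ng : nbhs y [set z : config G A | z g = y g].
  apply: filterS (filterI ng ihs) => z [zg zs] g' /=.
  by rewrite inE => /orP[/eqP->//|]; exact: zs.
have /cvg_sup/(_ g) : y --> y by exact: cvg_id.
apply; exists [set z | z g = y g]; split => //.
by exists [set y g] => //; exact: discrete_open.
Qed.

End ConfigTopology.

Section ConfigMeasurability.
Context {A : alphabetType}.

Lemma open_borel_config (G : Type) (O : set (config G A)) :
  open O -> measurable (O : set (borel_config G A)).
Proof. exact: sub_sigma_algebra. Qed.

(** Shifts, coordinate permutations and restrictions off a site are all of this form, so one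
    measurability proof serves them all. *)
Definition reindex (G G' : Type) (t : G' -> G) (x : config G A) : config G' A :=
  x \o t.

Lemma measurable_reindex (G G' : Type) (t : G' -> G) :
  measurable_fun [set: borel_config G A]
    (reindex t : borel_config G A -> borel_config G' A).
Proof.
have h := @measurability _ _ (borel_config G A) (borel_config G' A) setT
  (reindex t) (@open (config G' A)).
apply: h => // _ [Q oQ <-].
rewrite setTI; apply: open_borel_config; apply/open_configP => y Oy.
have /open_configP/(_ _ Oy)[D fD DO] := oQ.
exists (t @` D); first exact: finite_image.
by move=> z zy; apply: DO => g Dg; apply: zy; exists g.
Qed.

Lemma fin_measurable_eval (G : Type) (g : G) :
  fin_measurable (fun x : borel_config G A => x g).
Proof.
move=> a; apply: open_borel_config; apply/open_configP => y ya.
by exists [set g] => // z /(_ g erefl) zg; rewrite /preimage/= zg.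
Qed.

End ConfigMeasurability.

(** * The symmetries of the measure *)

Section Recenter.
Context {R : realType} {A : alphabetType}.
Variable mu : probability (borel_config Zinf A) R.
Hypotheses (mu_shift : shift_invariant mu) (mu_perm : perm_invariant mu).

(** Shift by [g], then permutation of the coordinates. Permutations fix the origin, so the new
    symbol at 0 is the old one at [g]. *)
Definition recenter (r : finitary_perm) (g : Zinf) :
  borel_config Zinf A -> borel_config Zinf A :=
  reindex (fun h => perm_Zinf r h + g).

Lemma measurable_recenter r g :
  measurable_fun [set: borel_config Zinf A]
    (@recenter r g).
Proof. exact: measurable_reindex. Qed.

Lemma measure_recenter r g (B : set (borel_config Zinf A)) :
  measurable B -> mu (recenter r g @^-1` B) = mu B.
Proof.
move=> mB; rewrite -[RHS](mu_perm r)//.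
rewrite -(mu_shift g (B := perm_config r @^-1` B))//.
rewrite -[X in measurable X]setTI.
exact: (measurable_reindex (perm_Zinf r)).
Qed.

Lemma law_recenter (U : finType) (X : borel_config Zinf A -> U) r g u :
  fin_measurable X -> law mu (X \o recenter r g) u = law mu X u.
Proof. by move=> mX; rewrite /law -(measure_recenter r g (mX u)). Qed.

Lemma ent_recenter (U : finType) (X : borel_config Zinf A -> U) r g :
  fin_measurable X -> ent mu (X \o recenter r g) = ent mu X.
Proof. by move=> mX; apply: eq_bigr => u _; rewrite law_recenter. Qed.

End Recenter.

(** * Conditional probabilities given all other sites *)

Section ConditionalProbability.
Context {R : realType} {A : alphabetType}.
Variable mu : probability (borel_config Zinf A) R.

Lemma measurable_restrict_off g :
  measurable_fun [set: borel_config Zinf A]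
    (restrict_off g : borel_config Zinf A -> borel_config (off g) A).
Proof. exact: (measurable_reindex (fun h : off g => val h)). Qed.

(** A version [p] is not assumed nonnegative. The defining identity on the whole space makes its
    integral a probability, and a finite integral forces integrability. *)
Lemma integrable_cond_prob g (p : config (off g) A -> A -> R) a :
  is_cond_prob mu p ->
  mu.-integrable setT (fun x => (p (restrict_off g x) a)%:E).
Proof.
move=> /(_ a)[mp /(_ setT measurableT)]; rewrite preimage_setT setTI => hp.
have mpr := measurableT_comp mp (@measurable_restrict_off g).
have mE := (measurable_EFinP _ _).2 mpr.
apply/integrableP; split=> //; apply/abse_integralP => //.
rewrite hp gee0_abs//; apply: (@le_lt_trans _ _ 1%E); last exact: ltry.
exact: (probability_le1 _ (fin_measurable_eval g a)).
Qed.

(** Under the law [nu] of x off [g], both versions have the same integral over every measurable set,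
    so they agree [nu]-a.e.; the null set is then pulled back to [mu]. *)
Lemma cond_prob_unique g (p p' : config (off g) A -> A -> R) a :
  is_cond_prob mu p -> is_cond_prob mu p' ->
  {ae mu, forall x, p (restrict_off g x) a = p' (restrict_off g x) a}.
Proof.
move=> hp hp'; have mr := @measurable_restrict_off g.
have ip := integrable_cond_prob a hp; have ip' := integrable_cond_prob a hp'.
pose r := MeasurableFun.Pack
  (MeasurableFun.Class (isMeasurableFun.Build _ _ _ _ _ mr)).
pose nu := distribution mu r.
have mE := (measurable_EFinP _ _).2 (hp a).1.
have mE' := (measurable_EFinP _ _).2 (hp' a).1.
have [N [mN N0 sN]] : ae_eq nu setT (fun y => (p y a)%:E) (fun y => (p' y a)%:E).
  apply: integral_ae_eq => //.
    by apply: integrable_pushforward.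
  move=> E _ ME; rewrite /nu /distribution !integral_pushforward//.
  - by rewrite (hp a).2// (hp' a).2.
  - by apply: integrableS ip' => //; rewrite -[X in measurable X]setTI;
      exact: (mr measurableT _ ME).
  - by apply: integrableS ip => //; rewrite -[X in measurable X]setTI;
      exact: (mr measurableT _ ME).
exists (restrict_off g @^-1` N); split.
- by rewrite -[X in measurable X]setTI; exact: (mr measurableT _ mN).
- exact: N0.
- by move=> x /= px; apply: sN => /= /(_ Logic.I) [].
Qed.

End ConditionalProbability.

(** * Equivariance of conditional probabilities *)

Lemma perm_Zinf0 r : perm_Zinf r 0 = 0.
Proof. by apply/malgP => i; rewrite mcoeff_perm_Zinf !mcoeff0. Qed.

Lemma finite_fperm_inv (r : finitary_perm) :
  finite_set [set i | fperm_inv r i <> i].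
Proof.
apply: sub_finite_set (finite_fperm r) => i /= ri ri'.
by apply: ri; rewrite -{1}ri' fpermK.
Qed.

Definition inv_perm (r : finitary_perm) : finitary_perm :=
  FinitaryPerm (fperm_invK r) (fpermK r) (finite_fperm_inv r).

Lemma perm_ZinfVK r : cancel (perm_Zinf (inv_perm r)) (perm_Zinf r).
Proof. by move=> g; apply/malgP => i; rewrite !mcoeff_perm_Zinf /= fpermK. Qed.

Lemma perm_ZinfK r : cancel (perm_Zinf r) (perm_Zinf (inv_perm r)).
Proof. by move=> g; apply/malgP => i; rewrite !mcoeff_perm_Zinf /= fperm_invK. Qed.

Lemma perm_Zinf_eq0 r g : (perm_Zinf r g == 0) = (g == 0).
Proof. by rewrite -{1}(perm_Zinf0 r) (inj_eq (can_inj (perm_ZinfK r))). Qed.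

Section CondProbEquivariance.
Context {R : realType} {A : alphabetType}.
Variable mu : probability (borel_config Zinf A) R.
Hypotheses (mu_shift : shift_invariant mu) (mu_perm : perm_invariant mu).

(** Change of variables, [mu] being its own push-forward under [recenter r g]. *)
Lemma integral_recenter r g (D : set (borel_config Zinf A)) (f : config Zinf A -> R) :
  measurable D -> measurable_fun [set: borel_config Zinf A] f ->
  mu.-integrable setT (EFin \o f) ->
  (\int[mu]_(x in recenter r g @^-1` D) (f (recenter r g x))%:E =
   \int[mu]_(x in D) (f x)%:E)%E.
Proof.
move=> mD mf fi; have mt := @measurable_recenter A r g.
have mE := (measurable_EFinP _ _).2 mf.
pose t := MeasurableFun.Pack
  (MeasurableFun.Class (isMeasurableFun.Build _ _ _ _ _ mt)).
have eqm (B : set (borel_config Zinf A)) : measurable B -> pushforward mu t B = mu B.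
  by move=> mB; rewrite -[RHS](measure_recenter mu_shift mu_perm r g mB).
have fti : mu.-integrable setT ((EFin \o f) \o t).
  apply/integrableP; split; first exact: (measurableT_comp mE mt).
  have /integrableP[_] := fi; congr (_ < _)%E.
  rewrite (eq_measure_integral (pushforward mu t)); last by move=> B mB _; exact/esym/eqm.
  rewrite ge0_integral_pushforward//; exact: measurableT_comp.
rewrite [RHS](eq_measure_integral (pushforward mu t)); last first.
  by move=> B mB _; exact/esym/eqm.
rewrite integral_pushforward//; apply: integrableS fti => //.
rewrite -[X in measurable X]setTI; exact: (mt measurableT _ mD).
Qed.

(** The version at 0, transported by the symmetry, satisfies the defining identity at [g];
    uniqueness of conditional probabilities concludes. *)
Lemma cond_prob_recenter (r : finitary_perm) (g : Zinf)
    (p : config (off g) A -> A -> R) (p0 : config (off 0) A -> A -> R) :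
  is_cond_prob mu p -> is_cond_prob mu p0 ->
  {ae mu, forall x, forall a,
    p (restrict_off g x) a = p0 (restrict_off 0 (recenter r g x)) a}.
Proof.
move=> hp hp0; apply: filter_forall => a.
(* [tau] and [sigma] are the mutually inverse bijections between the sites off 0 and the sites off
   [g] induced by [recenter r g]. *)
have tau_subproof (h : off 0) : perm_Zinf r (val h) + g != g.
  by rewrite -subr_eq0 addrK perm_Zinf_eq0 (valP h).
pose tau (h : off 0) : off g := exist (fun k => is_true (k != g)) _ (tau_subproof h).
have sigma_subproof (h : off g) : perm_Zinf (inv_perm r) (val h - g) != 0.
  by rewrite perm_Zinf_eq0 subr_eq0 (valP h).
pose sigma (h : off g) : off 0 := exist (fun k => is_true (k != 0)) _ (sigma_subproof h).
have tauE x : reindex tau (restrict_off g x) = restrict_off 0 (recenter r g x).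
  by [].
have sigmaE x : reindex sigma (restrict_off 0 (recenter r g x)) = restrict_off g x.
  apply/funext => h; rewrite /reindex/= /restrict_off /recenter /reindex/=.
  by rewrite perm_ZinfVK subrK.
pose p' y b := p0 (reindex tau y) b.
suff hp' : is_cond_prob mu p' by have := cond_prob_unique a hp hp'.
move=> b; split.
  exact: (measurableT_comp (hp0 b).1 (@measurable_reindex A _ _ tau)).
move=> B mB; pose B' := reindex sigma @^-1` B : set (borel_config (off 0) A).
have mB' : measurable B'.
  rewrite -[X in measurable X]setTI.
  exact: (@measurable_reindex A _ _ sigma measurableT _ mB).
have BE : restrict_off g @^-1` B = recenter r g @^-1` (restrict_off 0 @^-1` B').
  by apply/seteqP; split => x; rewrite /B' /preimage/= sigmaE.
have mr0 := @measurable_restrict_off A 0.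
rewrite BE (@integral_recenter r g _ (fun x => p0 (restrict_off 0 x) b)); last 3 first.
- by rewrite -[X in measurable X]setTI; exact: (mr0 measurableT _ mB').
- exact: (measurableT_comp (hp0 b).1 mr0).
- exact: (integrable_cond_prob b hp0).
rewrite (hp0 b).2// -[LHS](measure_recenter mu_shift mu_perm r g); last first.
  apply: measurableI; last exact: (fin_measurable_eval 0 b).
  by rewrite -[X in measurable X]setTI; exact: (mr0 measurableT _ mB').
congr (mu _); apply/seteqP; split => x [xB x0]; split => //; move: x0;
  by rewrite /recenter /reindex /= perm_Zinf0 add0r.
Qed.

End CondProbEquivariance.

(** * Variables determined by finite windows *)

Lemma in_folner n g : (g \in folner n) = `[< box n g >].
Proof.
rewrite in_fset_set; last exact: finite_box.
by apply/idP/asboolP; rewrite inE.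
Qed.

Lemma box_exists g : exists n, box n g.
Proof.
have [n supp] : exists n, forall i, i \in msupp g -> (i + `|g@_i| < n)%N.
  exists (\max_(i <- msupp g) (i + `|g@_i|%N).+1)%N => i gi.
  exact: (@leq_bigmax_seq _ _ xpredT (fun i => (i + `|g@_i|%N).+1)).
exists n.
split=> i hi.
  have [/supp|] := boolP (i \in msupp g); first by move: (g@_i) => m; lia.
  by rewrite -mcoeff_eq0 => /eqP->; lia.
by apply/eqP; rewrite mcoeff_eq0; apply/negP => /supp; lia.
Qed.

Lemma box_le m n g : (m <= n)%N -> box m g -> box n g.
Proof.
move=> mn [h1 h2]; split=> i hi; last by apply: h2; lia.
have [im|im] := ltnP i m; last by rewrite h2//; lia.
by have := h1 i im; move: (g@_i) => k; lia.
Qed.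

Lemma finite_box_exists (I : Type) (D : set I) (f : I -> Zinf) :
  finite_set D -> exists n, forall i, D i -> box n (f i).
Proof.
move=> /(@finite_seqP {classic I})[s ->].
elim: s => [|i s [n ihn]]; first by exists 0%N.
have [m hm] := box_exists (f i); exists (maxn m n) => j.
rewrite /= inE => /orP[/eqP->|/ihn].
  by apply: box_le hm; exact: leq_maxl.
by apply: box_le; exact: leq_maxr.
Qed.

Section Approx.
Context {R : realType} {A : alphabetType}.
Variable mu : probability (borel_config Zinf A) R.
Local Notation Omega := (borel_config Zinf A).

Definition fam (B : finType) (Y : Zinf -> Omega -> B) (S : {fset Zinf})
  (x : Omega) : {ffun S -> B} := [ffun g => Y (val g) x].

Definition window : forall S : {fset Zinf}, Omega -> {ffun S -> A} :=
  fam (fun g x => x g).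

Lemma eq_fam (B : finType) (Y : Zinf -> Omega -> B) (S : {fset Zinf}) x x' :
  fam Y S x = fam Y S x' <-> forall g, g \in S -> Y g x = Y g x'.
Proof.
split=> [/ffunP h g gS|h]; first by have := h [` gS]%fset; rewrite !ffunE.
by apply/ffunP => g; rewrite !ffunE; exact/h/valP.
Qed.

Lemma fin_measurable_fam (B : finType) (Y : Zinf -> Omega -> B) S :
  (forall g, fin_measurable (Y g)) -> fin_measurable (fam Y S).
Proof. by move=> mY; apply: fin_measurable_ffun. Qed.

Lemma fin_measurable_window S : fin_measurable (window S).
Proof. by apply: fin_measurable_fam => g; exact: fin_measurable_eval. Qed.
Hint Resolve fin_measurable_window : core.

(** The entropy form of the statement that [V] is almost surely a function of x off [g], expressed
    with finite windows only. *)
Definition approximable (g : Zinf) (B : finType) (V : Omega -> B) :=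
  forall e : R, 0 < e -> exists2 S : {fset Zinf}, g \notin S &
    cent mu V (window S) <= e.

Lemma approximable_determined g (B B' : finType) (V : Omega -> B) (V' : Omega -> B') :
  fin_measurable V -> (forall x x', V x = V x' -> V' x = V' x') ->
  approximable g V -> approximable g V'.
Proof.
move=> mV VV' hV e e0; have [S gS hS] := hV e e0; exists S => //.
by apply: le_trans hS; apply: cent_le => // x x' /VV'.
Qed.

Lemma approximable_pair g (B B' : finType) (V : Omega -> B) (V' : Omega -> B') :
  fin_measurable V -> fin_measurable V' ->
  approximable g V -> approximable g V' -> approximable g (fun x => (V x, V' x)).
Proof.
move=> mV mV' hV hV' e e0; have e20 : 0 < e / 2 by rewrite divr_gt0.
have [S gS hS] := hV _ e20; have [S' gS' hS'] := hV' _ e20.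
exists (S `|` S')%fset; first by rewrite in_fsetU negb_or gS.
apply: le_trans (cent_pair_le _ mV mV' _) _ => //.
rewrite [e]splitr lerD//.
  apply: le_trans hS; apply: cent_antimono => // x x' /eq_fam h.
  by apply/eq_fam => h' h'S; apply: h; rewrite in_fsetU h'S.
apply: le_trans hS'; apply: cent_antimono => // x x' /eq_fam h.
by apply/eq_fam => h' h'S; apply: h; rewrite in_fsetU h'S orbT.
Qed.

Lemma approximable_window g (B : finType) (V : Omega -> B) S : g \notin S ->
  fin_measurable V -> (forall x x', window S x = window S x' -> V x = V x') ->
  approximable g V.
Proof. by move=> gS mV SV e e0; exists S => //; rewrite cent_eq0// ltW. Qed.

Lemma approximable_fam g (B : finType) (Y : Zinf -> Omega -> B) (S : {fset Zinf}) :
  (forall h, fin_measurable (Y h)) -> (forall h, approximable g (Y h)) ->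
  approximable g (fam Y S).
Proof.
move=> mY hY; elim/finSet_rect: S => S ih.
have [->|/fset0Pn[h hS]] := eqVneq S fset0.
  apply: (@approximable_window _ _ _ fset0) => //; first exact: fin_measurable_fam.
  by move=> x x' _; apply/eq_fam.
apply: (approximable_determined _ _ (approximable_pair _ _ (hY h) (ih (S `\ h)%fset _))) => //.
- by apply: fin_measurable_pair => //; exact: fin_measurable_fam.
- move=> x x' [hh /eq_fam hS']; apply/eq_fam => h' h'S.
  by have [->//|h'h] := eqVneq h' h; apply: hS'; rewrite !inE h'h.
- exact: fin_measurable_fam.
- exact: fproperD1.
Qed.

Lemma approximable_setC g (D : set Omega) : measurable D ->
  approximable g (fun x => `[< D x >]) -> approximable g (fun x => `[< (~` D) x >]).
Proof.
move=> mD; apply: approximable_determined; first exact: fin_measurable_bool.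
by move=> x x' h; rewrite !asbool_neg h.
Qed.

Lemma approximable_bigsetU g (D : nat -> set Omega) n : (forall i, measurable (D i)) ->
  (forall i, approximable g (fun x => `[< D i x >])) ->
  approximable g (fun x => `[< (\big[setU/set0]_(i < n) D i) x >]).
Proof.
move=> mD hD; elim: n => [|n ih].
  apply: (@approximable_window _ _ _ fset0) => //.
    by apply: fin_measurable_bool; rewrite big_ord0.
  by move=> x x' _; rewrite big_ord0; congr asbool.
have mU : measurable (\big[setU/set0]_(i < n) D i) by exact: bigsetU_measurable.
apply: (approximable_determined _ _ (approximable_pair _ _ ih (hD n))).
- by apply: fin_measurable_pair; exact: fin_measurable_bool.
- by move=> x x' [h1 h2]; rewrite big_ord_recr/= !asbool_or h1 h2.
- exact: fin_measurable_bool.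
- exact: fin_measurable_bool.
Qed.

(** A large finite union is approximable, and the remainder [E n] decreases to the empty set, so its
    probability, and with it its entropy, is small. *)
Lemma approximable_bigcup g (D : nat -> set Omega) : (forall i, measurable (D i)) ->
  (forall i, approximable g (fun x => `[< D i x >])) ->
  approximable g (fun x => `[< (\bigcup_i D i) x >]).
Proof.
move=> mD hD e e0; have e20 : 0 < e / 2 by rewrite divr_gt0.
pose U n := \big[setU/set0]_(i < n) D i.
pose E n := (\bigcup_i D i) `\` U n.
have mU n : measurable (U n) by exact: bigsetU_measurable.
have mE n : measurable (E n).
  by apply: measurableD => //; exact: bigcupT_measurable.
have [n En] : exists n, 3 * Num.sqrt (fine (mu (E n))) <= e / 2.
  have cE : fine (mu (E n)) @[n --> \oo] --> (0 : R).
    apply: fine_cvg; rewrite -[0%:E](measure0 mu) (_ : set0 = \bigcap_n E n).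
      apply: nonincreasing_cvg_mu => //.
      - by rewrite -ge0_fin_numE// fin_num_measure.
      - exact: bigcapT_measurable.
      - move=> m n mn; apply/subsetPset; apply: setDS.
        exact: subset_bigsetU.
    apply/seteqP; split => // x Ex.
    have [[i _ Dix] _] := Ex 0%N Logic.I.
    have [_] := Ex i.+1 Logic.I; apply.
    by rewrite /U big_ord_recr/=; right.
  (* This is the probability at which the bound 3 sqrt p of [ent_bool_le] equals e / 2. *)
  pose r := (e / 2 / 3) ^+ 2.
  have r0 : 0 < r by rewrite exprn_gt0// divr_gt0.
  have /cvgr_le/(_ r r0)[n _ /(_ n (leqnn n)) hn] := cE; exists n.
  rewrite mulrC -ler_pdivlMr//.
  have e6 : 0 <= e / 2 / 3 by rewrite ltW// divr_gt0.
  by rewrite -[leRHS]ger0_norm// -sqrtr_sqr ler_sqrt// sqr_ge0.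
have [S gS hS] := approximable_bigsetU n mD hD e20; exists S => //.
apply: le_trans (_ : cent mu (fun x => (`[< U n x >], `[< E n x >])) (window S) <= _).
  apply: cent_le => //.
    by apply: fin_measurable_pair; exact: fin_measurable_bool.
  move=> x x' [h1 h2] _.
  have UE y : `[< (\bigcup_i D i) y >] = `[< U n y >] || `[< E n y >].
    rewrite -asbool_or; congr asbool; apply/propext; rewrite /E; split.
      by move=> Dy; have [Uy|nUy] := pselect (U n y); [left|right].
    case=> [|[]//]; rewrite /U -bigcup_mkord => -[i _ Diy]; by exists i.
  by rewrite !UE h1 h2.
apply: le_trans (cent_pair_le _ _ _ _) _ => //; try exact: fin_measurable_bool.
rewrite [e]splitr lerD//; apply: le_trans En.
apply: le_trans (ent_bool_le _ (mE n)).
by apply: cent_le_ent => //; exact: fin_measurable_bool.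
Qed.

(** The events with this property form a sigma-algebra, so it suffices to treat open sets. *)
Lemma approximable_restrict_off g (D : set (borel_config (off g) A)) : measurable D ->
  approximable g (fun x => `[< D (restrict_off g x) >]).
Proof.
move=> mD.
pose M := [set D : set (borel_config (off g) A) | measurable D /\
  approximable g (fun x => `[< D (restrict_off g x) >])].
suff : M D by case.
have mpre (E : set (borel_config (off g) A)) : measurable E ->
    measurable (restrict_off g @^-1` E : set Omega).
  move=> mE; rewrite -[X in measurable X]setTI.
  exact: (@measurable_restrict_off A g measurableT _ mE).
suff : <<s @open (config (off g) A) >> `<=` M by apply.
apply: smallest_sub.
  split.
  - split=> //; apply: (@approximable_window _ _ _ fset0) => //.
    exact: (fin_measurable_bool (mpre _ measurable0)).
  - move=> E [mE hE]; rewrite setTD; split; first exact: measurableC.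
    exact: (approximable_setC (mpre _ mE)).
  - move=> E hE; split; first by apply: bigcupT_measurable => i; case: (hE i).
    apply: (@approximable_bigcup g (fun i => restrict_off g @^-1` E i)) => i.
      by apply: mpre; case: (hE i).
    by case: (hE i).
move=> Q oQ; have mQ := open_borel_config oQ; split=> //.
(* [QN N] collects the configurations whose restriction to the N-th box already forces membership in
   [Q]. These sets are determined by a finite window avoiding [g], and their union is the open set
   [Q]. *)
pose agree N (y z : config (off g) A) := forall h, val h \in folner N -> z h = y h.
pose QN N := [set y | forall z, agree N y z -> Q z].
have oQN N : open (QN N).
  apply/open_configP => y QNy.
  exists [set h : off g | val h \in folner N].
    apply: (@finite_preimage _ _ [set h | h \in folner N] val); last exact: finite_fset.
    by move=> h h' _ _ /val_inj.
  move=> z zy z' zz'; apply: QNy => h hN; rewrite -zy//; exact: zz'.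
have QE : Q = \bigcup_N QN N.
  apply/seteqP; split=> [y Qy|y [N _]]; last exact.
  have /open_configP/(_ _ Qy)[D' fD' D'Q] := oQ.
  have [N hN] := finite_box_exists (fun h : off g => val h) fD'.
  exists N => // z yz; apply: D'Q => h D'h; apply: yz.
  by rewrite in_folner; apply/asboolP/hN.
rewrite [X in approximable _ (fun x => `[< X _ >])]QE.
apply: (@approximable_bigcup g (fun N => restrict_off g @^-1` QN N)) => N.
  exact: mpre (open_borel_config (oQN N)).
apply: (@approximable_window _ _ _ (folner N `\ g)%fset).
- by rewrite in_fsetD1 eqxx.
- exact: (fin_measurable_bool (mpre _ (open_borel_config (oQN N)))).
move=> x x' /eq_fam xx'; congr asbool; apply/propext.
have {}xx' (h : off g) : val h \in folner N -> x (val h) = x' (val h).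
  by move=> hN; apply: xx'; rewrite in_fsetD1 hN (valP h).
by split=> h z hz; apply: h => h' h'N; rewrite hz// /restrict_off xx'.
Qed.

End Approx.

(** * Moving windows into blocks of coordinates *)

Section BlockSwap.
Variables (m i : nat).

(** Carries a vector supported on the first [m] coordinates into block [i], blocks being numbered
    from 0; for [i] or [m] zero it is the identity. *)
Definition block_swap_fun (j : nat) : nat :=
  if (j < m)%N then (i * m + j)%N
  else if (i * m <= j < i * m + m)%N then (j - i * m)%N else j.

Lemma block_swap_funK : involutive block_swap_fun.
Proof.
move=> j; rewrite /block_swap_fun.
(* The two exchanged blocks either coincide or are disjoint. *)
have : ((i * m = 0) \/ (m <= i * m))%N by case: (posnP i) => [->|/leq_pmull]; [left|right].
move: (i * m)%N => im [i0|mim]; repeat case: ifP; lia.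
Qed.

Lemma finite_block_swap : finite_set [set j | block_swap_fun j <> j].
Proof.
apply: (@sub_finite_set _ _ `I_(i * m + m)); last exact: finite_II.
move=> j /=; rewrite /block_swap_fun; repeat case: ifP; lia.
Qed.

Definition block_swap : finitary_perm :=
  FinitaryPerm block_swap_funK block_swap_funK finite_block_swap.

Lemma mcoeff_block_swap (s : Zinf) (j : nat) :
  (forall l, (m <= l)%N -> s@_l = 0) ->
  (perm_Zinf block_swap s)@_j =
  if (i * m <= j < i * m + m)%N then s@_(j - i * m)%N else 0.
Proof.
move=> s0; rewrite mcoeff_perm_Zinf /= /block_swap_fun.
case: ifP => jm; last first.
  by case: ifP => // _; apply: s0; lia.
case: (posnP i) => [->|i0]; first by rewrite !mul0n subn0 add0n jm.
have mim : (m <= i * m)%N by rewrite leq_pmull.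
by rewrite s0 ?ifF//; lia.
Qed.

End BlockSwap.

(** * Good blocks and the enumeration key *)

Section GoodBlocks.
Variables (m M n : nat).

(** The inequalities leave room to add an integer of absolute value less than [M] without leaving
    [-n, n]; they imply [M] <= [n], which gives the lower bound. *)
Definition good_value (v : int) : bool :=
  [&& (M %| v)%Z, 0 <= v & v + M%:Z <= n%:Z].

Definition good_block (i : nat) (g : Zinf) : bool :=
  [forall j : 'I_m, good_value (g@_(i * m + j)%N)].

Definition divisible_count (g : Zinf) : nat :=
  (\sum_(l < n) (M %| g@_(val l))%Z)%N.

Definition bad_sites : {fset Zinf} :=
  [fset g in folner n | ~~ [exists i : 'I_(n %/ m), good_block i g]]%fset.

Lemma box_good_block i g s : box n g -> good_block i g ->
  (forall l, (m <= l)%N -> s@_l = 0) -> (forall l, `|s@_l| < M%:Z) ->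
  (i * m + m <= n)%N -> box n (perm_Zinf (block_swap m i) s + g).
Proof.
move=> [g1 g2] /forallP gi s0 sM imn; split=> l ln; rewrite mcoeffD mcoeff_block_swap//.
  case: ifP => [lim|_]; last by rewrite add0r; exact: g1.
  have lm : (l - i * m < m)%N by lia.
  have := gi (Ordinal lm); rewrite /good_value /= subnKC; last by lia.
  move=> /and3P[_]; have := sM (l - i * m)%N.
  by move: (s@_ _) (g@_ _) => a b; lia.
by rewrite g2// addr0 ifF//; lia.
Qed.

(** Every coordinate of [g] in the block is counted, and those outside it do not change. A nonzero
    entry of [s] is too small to be a multiple of [M], so it destroys the divisibility of its
    coordinate. *)
Lemma divisible_count_lt i g s : good_block i g ->
  (forall l, (m <= l)%N -> s@_l = 0) -> (forall l, `|s@_l| < M%:Z) ->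
  (i * m + m <= n)%N -> s != 0 ->
  (divisible_count (perm_Zinf (block_swap m i) s + g) < divisible_count g)%N.
Proof.
move=> /forallP gi s0 sM imn sn0.
have [j sj] : exists j, s@_j != 0.
  apply: contrapT => /forallNP h; move/eqP: sn0; apply; apply/malgP => j.
  by rewrite mcoeff0; apply/eqP/negPn/negP; exact: h.
have jm : (j < m)%N by rewrite ltnNge; apply: contra sj => /s0->.
have ln : (i * m + j < n)%N by lia.
have dvd l : (i * m <= l < i * m + m)%N -> (M %| g@_l)%Z.
  move=> lim; have lm : (l - i * m < m)%N by lia.
  have := gi (Ordinal lm); rewrite /good_value /= subnKC; last by lia.
  by case/and3P.
rewrite /divisible_count (bigD1 (Ordinal ln))//= [ltnRHS](bigD1 (Ordinal ln))//=.
rewrite (dvd (i * m + j)%N); last by lia.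
rewrite add1n ltnS.
rewrite [X in (nat_of_bool X + _)%N](_ : _ = false); last first.
  rewrite mcoeffD mcoeff_block_swap// ifT; last by lia.
  rewrite addKn; apply/negbTE; rewrite rpredDr; last by apply: dvd; lia.
  have := sM j; move: sj; move: (s@_j) => a a0 aM; apply/negP => /dvdzP[k ak].
  have k1 : 1 <= `|k|.
    rewrite -gtz0_ge1 normr_gt0; apply: contra a0 => /eqP k0.
    by rewrite ak k0 mul0r.
  by move: aM; rewrite ak normrM (ger0_norm (isT : 0 <= M%:Z)) ltNge ler_peMl.
rewrite add0n; apply: leq_sum => l _; rewrite mcoeffD mcoeff_block_swap//.
case: ifP => lim; last by rewrite add0r.
by rewrite (dvd l lim) leq_b1.
Qed.

End GoodBlocks.

(** * Counting the bad sites *)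

Section BoxCounting.
Variables (n : nat).

Definition digit (g : Zinf) (l : nat) : 'I_n.*2.+1 := inord `|g@_l + n%:Z|.

Lemma digitE g l : box n g -> (l < n)%N -> (digit g l)%:Z = g@_l + n%:Z.
Proof.
move=> [gn _] ln; have := gn l ln; rewrite /digit.
by move: (g@_l) => a an; rewrite inordK; lia.
Qed.

Definition of_digits (f : {ffun 'I_n -> 'I_n.*2.+1}) : Zinf :=
  [malg i in [fset j | j in iota 0 n]%fset =>
     oapp (fun l : 'I_n => (f l)%:Z - n%:Z) 0 (insub i)].

Lemma mcoeff_of_digits f (l : 'I_n) : (of_digits f)@_(val l) = (f l)%:Z - n%:Z.
Proof.
by rewrite mcoeffE !inE mem_iota /= add0n ltn_ord valK.
Qed.

Lemma box_of_digits f : box n (of_digits f).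
Proof.
split=> l ln.
  by rewrite (mcoeff_of_digits f (Ordinal ln)); have := ltn_ord (f (Ordinal ln)); lia.
by rewrite mcoeffE !inE mem_iota /= add0n ltnNge ln.
Qed.

Lemma card_folner_ge : (n.*2.+1 ^ n <= #|` folner n|)%N.
Proof.
rewrite -[X in (_ ^ X)%N]card_ord -[X in (X ^ _)%N]card_ord -card_ffun.
rewrite cardE -(size_map of_digits) uniq_leq_size//.
  rewrite map_inj_uniq ?enum_uniq// => f f' ff'; apply/ffunP => l.
  apply/val_inj; have := mcoeff_of_digits f l; rewrite ff' mcoeff_of_digits.
  by move=> /addIr[].
by move=> _ /mapP[f _ ->]; rewrite in_folner; apply/asboolP/box_of_digits.
Qed.

Variables (m M : nat).

Definition good_digits : {set 'I_n.*2.+1} :=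
  [set v : 'I_n.*2.+1 | good_value M n (v%:Z - n%:Z)]%SET.

Lemma card_good_digits_ge : (0 < M)%N -> (n %/ M <= #|good_digits|)%N.
Proof.
move=> M0; rewrite -[leqLHS]card_ord.
(* The multiples k M with k below n / M are good values; as digits they are translated by [n]. *)
pose f (k : 'I_(n %/ M)) : 'I_n.*2.+1 := inord (n + k * M).
have kM (k : 'I_(n %/ M)) : (k * M + M <= n)%N.
  by rewrite -mulSnr; apply: leq_trans (leq_divM n M); rewrite leq_mul2r ltn_ord orbT.
have fE k : f k = (n + k * M)%N :> nat by rewrite inordK//; have := kM k; lia.
rewrite -(card_imset predT (f := f)); last first.
  move=> k k' /(congr1 val) /=; rewrite !fE => /eqP.
  by rewrite eqn_add2l eqn_pmul2r// => /eqP/val_inj.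
apply: subset_leq_card; apply/fintype.subsetP => _ /imsetP[k _ ->].
rewrite inE fE /good_value.
have -> : (n + k * M)%:Z - n%:Z = k%:Z * M%:Z by lia.
rewrite dvdz_mull//=; have := kM k; lia.
Qed.

Definition bad_block : {set {ffun 'I_m -> 'I_n.*2.+1}} :=
  (~: [set f in ffun_on (mem good_digits)])%SET.

(** A bad site is encoded injectively by the contents of its n / m blocks, none of which is good,
    and by its n mod m remaining coordinates, which are free. *)
Lemma card_bad_sites_le : (0 < m)%N ->
  (#|` bad_sites m M n| <= #|bad_block| ^ (n %/ m) * n.*2.+1 ^ (n %% m))%N.
Proof.
move=> m0.
pose enc (g : Zinf) :
    {ffun 'I_(n %/ m) -> {ffun 'I_m -> 'I_n.*2.+1}} * {ffun 'I_(n %% m) -> 'I_n.*2.+1} :=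
  ([ffun i : 'I_(n %/ m) => [ffun j : 'I_m => digit g (i * m + j)]],
   [ffun l : 'I_(n %% m) => digit g (n %/ m * m + l)]).
have lt_n (i : 'I_(n %/ m)) (j : 'I_m) : (i * m + j < n)%N.
  have := leq_divM n m; have := leq_mul (ltn_ord i) (leqnn m); rewrite mulSn.
  have := ltn_ord j; move: (n %/ m * m)%N (i * m)%N; lia.
have -> : (n.*2.+1 ^ (n %% m) =
    #|[set: {ffun 'I_(n %% m) -> 'I_n.*2.+1}]%SET|)%N.
  by rewrite cardsT card_ffun !card_ord.
have -> : (#|bad_block| ^ (n %/ m) =
    #|[set f : {ffun 'I_(n %/ m) -> _} in ffun_on (mem bad_block)]%SET|)%N.
  by rewrite [RHS]cardsE card_ffun_on card_ord.
rewrite -cardsX cardE -(size_map enc) uniq_leq_size//.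
  rewrite map_inj_in_uniq ?fset_uniq// => g g'.
  rewrite !inE /= !in_folner => /andP[/asboolP gn _] /andP[/asboolP gn' _] gg'.
  apply/malgP => l; have [ln|ln] := ltnP l n; last first.
    by rewrite gn.2// gn'.2.
  suff dd : digit g l = digit g' l.
    by have := digitE gn ln; rewrite dd digitE// => /addIr.
  move: gg' => [/ffunP g1 /ffunP g2].
  have [lm|lm] := ltnP l (n %/ m * m).
    have im : (l %/ m < n %/ m)%N by rewrite ltn_divLR.
    have /ffunP/(_ (Ordinal (ltn_pmod l m0))) := g1 (Ordinal im).
    by rewrite !ffunE /= -divn_eq.
  have lm' : (l - n %/ m * m < n %% m)%N.
    by have := divn_eq n m; lia.
  by have := g2 (Ordinal lm'); rewrite !ffunE /= subnKC.
move=> _ /mapP[g gbad ->]; move: gbad.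
rewrite !inE /= in_folner => /andP[/asboolP gn bad].
rewrite mem_enum !inE /= andbT; apply/ffun_onP => i.
rewrite !inE; apply: contra bad => /ffun_onP good; apply/existsP; exists i.
apply/forallP => j; have := good j; rewrite !ffunE inE digitE// addrK//.
Qed.

End BoxCounting.

(** A digit is good with frequency at least c = 1 / (4 M), so a block is bad with frequency at most
    1 - c^m, and all n / m blocks are bad with frequency at most (1 - c^m)^(n/m), which tends to
    0. *)
Lemma bad_sites_density {R : realType} (m M : nat) (e : R) :
  (0 < m)%N -> (0 < M)%N -> 0 < e ->
  \forall n \near \oo,
    #|` bad_sites m M n|%:R <= e * #|` folner n|%:R.
Proof.
move=> m0 M0 e0; pose c : R := (4 * M%:R)^-1.
have M1 : (1 : R) <= M%:R by rewrite ler1n.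
have c0 : 0 < c by rewrite invr_gt0; lra.
have c1 : c <= 1 by rewrite invf_le1; lra.
have cm0 : 0 < c ^+ m by rewrite exprn_gt0.
have cm1 : c ^+ m <= 1 by rewrite exprn_ile1// (ltW c0).
have zlt1 : `|1 - c ^+ m| < 1 by rewrite ger0_norm; lra.
have [K _ hK] := cvgr_le _ (cvg_expr zlt1) _ e0.
(* [M] <= [n] makes n / M positive, as the bound on good digits requires; [K * m] <= [n] makes the
   number of blocks at least [K]. *)
exists (maxn M (K * m))%N => // n /=; rewrite geq_max => /andP[Mn Kn].
have hz : (1 - c ^+ m) ^+ (n %/ m) <= e by apply: hK; rewrite /= leq_divRL.
apply: le_trans (_ : (1 - c ^+ m) ^+ (n %/ m) * #|` folner n|%:R <= _); last first.
  by rewrite ler_wpM2r.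
have V0 : (0 : R) < n.*2.+1%:R by rewrite ltr0n.
apply: le_trans (_ : (1 - c ^+ m) ^+ (n %/ m) * n.*2.+1%:R ^+ n <= _); last first.
  by rewrite ler_wpM2l ?exprn_ge0 -?natrX ?ler_nat ?card_folner_ge//; lra.
apply: le_trans (_ : (#|bad_block n m M| ^ (n %/ m) * n.*2.+1 ^ (n %% m))%:R <= _).
  by rewrite ler_nat card_bad_sites_le.
rewrite natrM !natrX [X in _ <= _ * _ ^+ X](divn_eq n m) exprD mulnC exprM mulrA.
have z0 : 0 <= 1 - c ^+ m by lra.
rewrite ler_wpM2r ?exprn_ge0 ?(ltW V0)// -exprMn.
rewrite lerXn2r ?nnegrE ?mulr_ge0 ?exprn_ge0 ?(ltW V0)//.
have -> : (#|bad_block n m M|%:R : R) = n.*2.+1%:R ^+ m - #|good_digits n M|%:R ^+ m.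
  apply/eqP; rewrite eq_sym subr_eq -!natrX -natrD; apply/eqP; congr _%:R.
  rewrite addnC -[X in (_ ^ X + _)%N]card_ord -card_ffun_on /bad_block.
  by rewrite -[X in (X + _)%N]cardsE cardsC card_ffun !card_ord.
rewrite mulrBl mul1r lerB// -exprMn lerXn2r ?nnegrE ?mulr_ge0 ?(ltW c0) ?(ltW V0)//.
rewrite /c mulrC ler_pdivrMr; last lra.
have := card_good_digits_ge n M0 => hG.
(* From n < (n / M) M + M and n / M >= 1 follows 2 n + 1 <= 4 M (n / M). *)
have : (n.*2.+1 <= #|good_digits n M| * (4 * M))%N.
  have d1 : (1 <= n %/ M)%N by rewrite divn_gt0.
  have := divn_eq n M; have := ltn_pmod n M0; move: hG d1.
  move: (n %/ M)%N (n %% M)%N (#|_|) => q r G hG d1 rM nE.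
  nia.
by rewrite -(ler_nat R) !natrM.
Qed.

(** * Factors with zero entropy *)

Section ZeroEntropyFactor.
Context {R : realType} {A : alphabetType}.
Variable mu : probability (borel_config Zinf A) R.
Hypotheses (mu_shift : shift_invariant mu) (mu_perm : perm_invariant mu).
Local Notation Omega := (borel_config Zinf A).
Local Notation H := (ent mu).
Local Notation C := (cent mu).
Hint Resolve fin_measurable_window : core.

Lemma ent_ae (U : finType) (V V' : Omega -> U) :
  fin_measurable V -> fin_measurable V' -> {ae mu, forall x, V x = V' x} ->
  H V = H V'.
Proof.
move=> mV mV' [N [mN N0 sN]].
have le (W W' : Omega -> U) (a : U) : fin_measurable W -> fin_measurable W' ->
    (forall x, ~ N x -> W x = W' x) ->
    (mu (W @^-1` [set a]) <= mu (W' @^-1` [set a]))%E.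
  move=> mW mW' WW'.
  apply: (@le_trans _ _ (mu (W' @^-1` [set a] `|` N))).
    apply: le_measure; rewrite ?inE//; first exact: measurableU.
    move=> x /= Wx; have [Nx|Nx] := pselect (N x); first by right.
    by left; rewrite /= -WW'.
  apply: le_trans (measureU2 _ _ _) _ => //.
  by rewrite [X in (_ + X)%E]N0 adde0.
have VV' x : ~ N x -> V x = V' x by move=> Nx; apply: contrapT => h; exact/Nx/sN.
apply: eq_bigr => a _; suff -> : law mu V a = law mu V' a by [].
congr fine; apply/eqP; rewrite eq_le !le// => x Nx; exact/esym/VV'.
Qed.

Definition moved (r : finitary_perm) (g : Zinf) (S : {fset Zinf}) : {fset Zinf} :=
  [fset (perm_Zinf r s + g)%R | s in S]%fset.

Lemma window_moved r g S (x x' : Omega) :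
  window (moved r g S) x = window (moved r g S) x' <->
  window S (recenter r g x) = window S (recenter r g x').
Proof.
split=> /eq_fam h; apply/eq_fam => s sS.
  by apply: h; apply/imfsetP; exists s.
by have /imfsetP[t tS ->] := sS; exact: h.
Qed.

(** Up to a null set, the pair on the left is the pair on the right composed with the
    measure-preserving map [recenter r g]. *)
Lemma cent_moved (U : finType) (V V' : Omega -> U) r g S :
  fin_measurable V -> fin_measurable V' ->
  {ae mu, forall x, V' x = V (recenter r g x)} ->
  C V' (window (moved r g S)) = C V (window S).
Proof.
move=> mV mV' VV'.
have mrec (B : finType) (X : Omega -> B) : fin_measurable X ->
    fin_measurable (X \o recenter r g).
  move=> mX b; rewrite -[X in measurable X]setTI.
  exact: (@measurable_recenter A r g measurableT _ (mX b)).
rewrite /cent; congr (_ - _); last first.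
  rewrite -(ent_recenter mu_shift mu_perm r g (@fin_measurable_window A S)).
  apply: ent_eq => //; first exact: mrec.
  by move=> x x'; rewrite window_moved.
have mVS : fin_measurable (fun x => (V x, window S x)) by exact: fin_measurable_pair.
rewrite -(ent_recenter mu_shift mu_perm r g mVS).
rewrite (@ent_ae _ _ (fun x => (V (recenter r g x), window (moved r g S) x))); first last.
- case: VV' => N [mN N0 sN]; exists N; split=> // x nh; apply: sN => h.
  by apply: nh; rewrite /= h.
- by apply: fin_measurable_pair => //; exact: mrec.
- exact: fin_measurable_pair.
apply: ent_eq => //; first exact: mrec.
  by apply: fin_measurable_pair => //; exact: mrec.
by move=> x x' /=; split=> -[-> /window_moved h]; congr pair; exact: h.
Qed.

Let value (g : Zinf) (x : Omega) : A := x g.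

Let measurable_value g : fin_measurable (value g).
Proof. exact: fin_measurable_eval. Qed.

Lemma value_recenter r g : {ae mu, forall x, value g x = value 0 (recenter r g x)}.
Proof.
by apply: aeW => x; rewrite /value /recenter /reindex /= perm_Zinf0 add0r.
Qed.

(** The constant c: the entropy of x_0 conditioned on the whole of x off 0, written with finite
    windows only. *)
Definition rate : R :=
  inf [set C (value 0) (window S) | S in [set S : {fset Zinf} | 0 \notin S]].

Let rate_has_inf :
  has_inf [set C (value 0) (window S) | S in [set S : {fset Zinf} | 0 \notin S]].
Proof.
split; first by exists (C (value 0) (window fset0)); exists fset0.
by exists 0 => _ [S _ <-]; exact: cent_ge0.
Qed.

Lemma rate_adherent e : 0 < e ->
  exists2 S : {fset Zinf}, 0 \notin S & C (value 0) (window S) <= rate + e.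
Proof.
move=> e0; have [_ [S S0 <-] hS] := inf_adherent e0 rate_has_inf.
by exists S => //; exact: ltW.
Qed.

Lemma rate_le g S : g \notin S -> rate <= C (value g) (window S).
Proof.
(* A translation alone brings [g] to 0; [block_swap 0 0] acts as the identity. *)
move=> gS; pose r := block_swap 0 0.
pose S0 := [fset perm_Zinf (inv_perm r) (s - g)%R | s in S]%fset.
have -> : S = moved r g S0.
  apply/fsetP => s; apply/idP/imfsetP => [sS|[_ /imfsetP[t tS ->] ->]].
    exists (perm_Zinf (inv_perm r) (s - g)); first by apply/imfsetP; exists s.
    by rewrite perm_ZinfVK subrK.
  by rewrite perm_ZinfVK subrK.
rewrite (cent_moved S0 (measurable_value 0) (measurable_value g) (value_recenter r g)).
apply: ge_inf; first by case: rate_has_inf.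
exists S0 => //=; apply/negP => /imfsetP[s sS /eqP].
by rewrite eq_sym perm_Zinf_eq0 subr_eq0 => /eqP sg; rewrite sg (negbTE gS) in sS.
Qed.

(** The argument is run for any equivariant family whose member at 0 is approximable off 0; the
    support map is the instance used at the end. *)
Variables (B : finType) (u : Zinf -> Omega -> B).
Hypotheses (mu_u : forall g, fin_measurable (u g))
  (u_recenter : forall r g, {ae mu, forall x, u g x = u 0 (recenter r g x)})
  (approx_u0 : approximable mu 0 (u 0)).

(* A finitary permutation moves the coordinates of a finite window away from
   those of [g - h], so the window can be kept away from [g]. *)
Lemma approximable_u g h : approximable mu g (u h).
Proof.
move=> e e0; have [S S0 hS] := approx_u0 e0.
have [b1 hb1] := finite_box_exists id (finite_fset S).
have [b2 hb2] := box_exists (g - h).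
pose b := maxn b1 b2; pose r := block_swap b 1.
exists (moved r h S); last by rewrite (cent_moved S (mu_u 0) (mu_u h) (u_recenter r h)).
apply/negP => /imfsetP[s sS gE].
have sb l : (b <= l)%N -> s@_l = 0.
  by move=> bl; apply: (hb1 s sS).2; apply: leq_trans bl; exact: leq_maxl.
have {}gE : g - h = perm_Zinf r s by rewrite gE addrK.
(* The moved window vector vanishes below [b] and [g - h] vanishes from [b] on; being equal, both
   are 0, although 0 is not in [S]. *)
have gh0 : g - h = 0.
  apply/malgP => l; rewrite mcoeff0; have [lb|bl] := ltnP l b.
    by rewrite gE mcoeff_block_swap// mul1n ifF//; lia.
  by apply: hb2.2; apply: leq_trans bl; exact: leq_maxr.
have /eqP := esym gE; rewrite gh0 perm_Zinf_eq0 => /eqP s0.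
by rewrite s0 (negbTE S0) in sS.
Qed.

(** [K] is separate from [F] so that its sites can be removed one by one while u_F stays fixed. *)
Lemma ent_window_u_ge (F K : {fset Zinf}) :
  H (fam u F) + #|` K|%:R * rate <= H (fun x => (window K x, fam u F x)).
Proof.
have mF : fin_measurable (fam u F) by exact: fin_measurable_fam.
(* With [W] a window containing [K'], avoiding [g] and determining u_F up to [e]: c <= H(x_g | W) <=
   H(x_g | u_F, W) + H(u_F | W) <= H(x_g | x_K', u_F) + e. *)
have step g (K' : {fset Zinf}) : g \notin K' ->
    rate <= C (value g) (fun x => (window K' x, fam u F x)).
  move=> gK'; apply/ler_addgt0Pr => e e0.
  have [S gS hS] := approximable_fam F mu_u (approximable_u g) e0.
  have gKS : g \notin (K' `|` S)%fset by rewrite in_fsetU negb_or gK'.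
  have := rate_le gKS; set W := window (K' `|` S)%fset.
  have mW : fin_measurable W by [].
  have h1 : C (fam u F) W <= e.
    apply: le_trans hS; apply: cent_antimono => // x x' /eq_fam h.
    by apply/eq_fam => s sS; apply: h; rewrite in_fsetU sS orbT.
  have h2 : C (value g) W <= C (fun x => (value g x, fam u F x)) W.
    apply: cent_le => //; first exact: fin_measurable_pair.
    by move=> x x' [].
  have h3 := cent_chain mu (measurable_value g) mF mW.
  have : C (value g) (fun x => (fam u F x, W x)) <=
         C (value g) (fun x => (window K' x, fam u F x)).
    apply: cent_antimono => //; try exact: fin_measurable_pair.
    move=> x x' [hF /eq_fam h]; congr pair => //.
    by apply/eq_fam => s sS; apply: h; rewrite in_fsetU sS.
  lra.
elim/finSet_rect: K => K ih.
have [->|/fset0Pn[g gK]] := eqVneq K fset0.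
  rewrite cardfs0 mul0r addr0; apply: ent_le; first exact: fin_measurable_pair.
  by move=> x x' [].
have := ih (K `\ g)%fset (fproperD1 gK); rewrite (cardfsD1 g K) gK.
have := step g (K `\ g)%fset; rewrite in_fsetD1 eqxx => /(_ isT); rewrite /cent.
have -> : H (fun x => (window K x, fam u F x)) =
          H (fun x => (value g x, (window (K `\ g)%fset x, fam u F x))).
  apply: ent_eq; repeat apply: fin_measurable_pair => //.
  move=> x x'; split=> [[hg /eq_fam hK ->]|[/eq_fam hK ->]]; congr pair.
    apply/eq_fam => s sK; have [->//|sg] := eqVneq s g.
    by apply: hK; rewrite in_fsetD1 sg.
  - exact: hK.
  by congr pair; apply/eq_fam => s; rewrite in_fsetD1 => /andP[_]; exact: hK.
by rewrite natrD mulrDl mul1r; lra.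
Qed.

(* Chain rule along an enumeration of [F] by increasing [key]. *)
Lemma ent_fam_le (U : finType) (z : Zinf -> Omega -> U) (key : Zinf -> nat)
    (b : Zinf -> R) (F : {fset Zinf}) :
  (forall g, fin_measurable (z g)) ->
  (forall g K, g \in F -> (K `<=` F)%fset ->
    (forall h, h \in F -> (key h < key g)%N -> h \in K) ->
    C (z g) (fam z K) <= b g) ->
  H (fam z F) <= \sum_(g <- F) b g.
Proof.
move=> mz; elim/finSet_rect: F => F ih hb.
have [F0|/fset0Pn[g0 g0F]] := eqVneq F fset0.
  rewrite F0 big_seq_fset0.
  by rewrite (ent_const mu)// => x x'; apply/eq_fam => s; rewrite inE.
(* A site of maximal key comes last. Ties may be broken arbitrarily, since the conditioning set is
   only required to contain the sites of strictly smaller key. *)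
have [g gF gmax] : exists2 g, g \in F & forall h, h \in F -> (key h <= key g)%N.
  have := @arg_maxnP _ [` g0F]%fset xpredT (fun h : F => key (val h)) isT.
  case=> g _ gmax; exists (val g); first exact: valP.
  by move=> h hF; exact: (gmax [` hF]%fset).
have {}ih : H (fam z (F `\ g)%fset) <= \sum_(h <- (F `\ g)%fset) b h.
  apply: ih; first exact: fproperD1.
  move=> h K; rewrite in_fsetD1 => /andP[hg hF] KF hK; apply: hb => //.
    by apply: fsubset_trans KF _; exact: fsubD1set.
  move=> h' h'F h'h; apply: hK => //; rewrite in_fsetD1 h'F andbT.
  by apply: contraTneq h'h => ->; rewrite -leqNgt gmax.
rewrite (big_fsetD1 g)//=.
have : C (z g) (fam z (F `\ g)%fset) <= b g.
  apply: hb => //; first exact: fsubD1set.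
  by move=> h hF hg; rewrite in_fsetD1 hF andbT; apply: contraTneq hg => ->; rewrite ltnn.
rewrite /cent; have -> : H (fun x => (z g x, fam z (F `\ g)%fset x)) = H (fam z F).
  apply: ent_eq; [|apply: fin_measurable_pair => //|]; try exact: fin_measurable_fam.
  move=> x x'; split=> [/eq_fam h|[hg /eq_fam h]].
    congr pair; first exact: h.
    by apply/eq_fam => s; rewrite in_fsetD1 => /andP[_]; exact: h.
  apply/eq_fam => s sF; have [->//|sg] := eqVneq s g.
  by apply: h; rewrite in_fsetD1 sg.
by lra.
Qed.

Let pair_value (g : Zinf) (x : Omega) : A * B := (value g x, u g x).

Let measurable_pair_value g : fin_measurable (pair_value g).
Proof. exact: fin_measurable_pair. Qed.

Let pair_value_recenter r g :
  {ae mu, forall x, pair_value g x = pair_value 0 (recenter r g x)}.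
Proof.
have [N [mN N0 sN]] := u_recenter r g.
exists N; split => // x nh; apply: sN => h; apply: nh.
rewrite /= /pair_value h; congr pair.
by rewrite /value /recenter /reindex /= perm_Zinf0 add0r.
Qed.

(** The error is split in three: one third for a window nearly attaining [rate], one for a window
    nearly determining [u 0], and one for the bad sites. *)
Lemma ent_pair_value_le e : 0 < e -> \forall n \near \oo,
  H (fam pair_value (folner n)) <= #|` folner n|%:R * (rate + e).
Proof.
move=> e0; have e30 : 0 < e / 3 by rewrite divr_gt0.
have [S1 S10 hS1] := rate_adherent e30.
have [S2 S20 hS2] := approx_u0 e30.
pose S := (S1 `|` S2)%fset.
have S0 : 0 \notin S by rewrite in_fsetU negb_or S10.
have hS : C (pair_value 0) (window S) <= rate + e / 3 * 2.
  apply: le_trans (cent_pair_le mu _ _ _) _ => //.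
  have : C (value 0) (window S) <= C (value 0) (window S1).
    apply: cent_antimono => // x x' /eq_fam h.
    by apply/eq_fam => s sS; apply: h; rewrite in_fsetU sS.
  have : C (u 0) (window S) <= C (u 0) (window S2).
    apply: cent_antimono => // x x' /eq_fam h.
    by apply/eq_fam => s sS; apply: h; rewrite in_fsetU sS orbT.
  lra.
have [b0 hb0] := finite_box_exists id (finite_fset S).
(* The successor makes [m] positive. Entries of vectors in [S] are at most [m] in absolute value,
   hence strictly below [M]. *)
pose m := b0.+1; have hb s : s \in S -> box m s by move=> /hb0; exact: box_le.
pose M := m.+1.
have Ssupp s : s \in S -> forall l, (m <= l)%N -> s@_l = 0 by move=> /hb[].
have Sval s : s \in S -> forall l, `|s@_l| < M%:Z.
  move=> /hb[h1 h2] l; have [lm|ml] := ltnP l m; last by rewrite h2// normr0.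
  by have := h1 l lm; move: (s@_l) => a; lia.
(* [c] bounds the entropy of one symbol pair at a bad site, and the added 1 makes it positive. The
   rest of [b g] is nonnegative, since [hS] bounds a conditional entropy by it. *)
pose c : R := #|{: A * B}|%:R + 1.
have c0 : 0 < c by rewrite ltr_wpDl.
have e3c : 0 < e / 3 / c by rewrite divr_gt0.
have := @bad_sites_density R m M _ isT isT e3c; apply: filterS => n hbad.
pose b g := rate + e / 3 * 2 + c * (g \in bad_sites m M n)%:R.
apply: (@le_trans _ _ (\sum_(g <- folner n) b g)).
  apply: (ent_fam_le (key := divisible_count M n)) => // g K gF KF hK.
  rewrite /b; have [gbad|ggood] := boolP (g \in bad_sites m M n).
    rewrite mulr1; apply: le_trans (cent_le_ent mu _ _) _ => //.
      exact: fin_measurable_fam.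
    have := ent_le_card mu (pair_value g).
    have := cent_ge0 mu (measurable_pair_value 0) (@fin_measurable_window A S).
    rewrite /c; lra.
  rewrite mulr0 addr0.
  have [i gi] : exists i : 'I_(n %/ m), good_block m M n i g.
    apply/existsP; move: ggood; by rewrite !inE gF /= negbK.
  have gbox : box n g by apply/asboolP; rewrite -in_folner.
  have imn : (i * m + m <= n)%N.
    by rewrite -mulSnr; apply: leq_trans (leq_divM n m); rewrite leq_mul2r ltn_ord orbT.
  (* The window moved into the good block [i] stays in the box and has smaller key at each of its
     sites, so it lies in the past [K] of [g]. *)
  pose r := block_swap m i.
  apply: le_trans hS; rewrite -(cent_moved S _ _ (pair_value_recenter r g))//.
  apply: cent_antimono => //; first exact: fin_measurable_fam.
  move=> x x' /eq_fam h; apply/eq_fam => _ /imfsetP[s sS ->].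
  suff /h[] : perm_Zinf r s + g \in K by [].
  apply: hK.
    rewrite in_folner; apply/asboolP.
    exact: (box_good_block gbox gi (Ssupp s sS) (Sval s sS) imn).
  apply: (divisible_count_lt gi (Ssupp s sS) (Sval s sS) imn).
  by apply: contraNneq S0 => <-.
rewrite big_split/= big_const_seq count_predT iter_addr addr0 -mulr_natl -mulr_sumr.
have -> : \sum_(g <- folner n) (g \in bad_sites m M n)%:R = #|` bad_sites m M n|%:R :> R.
  rewrite -natr_sum; congr _%:R.
  rewrite (eq_bigr (fun g => if g \in bad_sites m M n then 1 else 0)%N); last first.
    by move=> g _; case: ifP.
  rewrite -big_mkcond sum1_count -size_filter; apply/perm_size/uniq_perm => //.
    by rewrite filter_uniq.
  by move=> g; rewrite mem_filter !inE /= andbC; case: (g \in folner n).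
have := ler_wpM2l (ltW c0) hbad.
rewrite [c * (_ * _)]mulrA [c * (_ / c)]mulrC divfK ?gt_eqF//; lra.
Qed.

Theorem zero_entropy_factor :
  (fun n => H (fam u (folner n)) / #|` folner n|%:R) @ \oo --> (0 : R).
Proof.
apply/cvgrPdist_le => e e0; have := ent_pair_value_le e0; apply: filterS => n hn.
have F0 : (0 : R) < #|` folner n|%:R.
  rewrite ltr0n; apply: leq_trans (card_folner_ge n); rewrite expn_gt0//.
rewrite sub0r normrN ger0_norm ?divr_ge0 ?ent_ge0//; last exact: fin_measurable_fam.
(* With [K] = [F] the lower and upper bounds on H(x_F, u_F) both contain |F| c, which cancels and
   leaves H(u_F) <= e |F|. *)
rewrite ler_pdivrMr//; have := ent_window_u_ge (folner n) (folner n).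
have -> : H (fun x => (window (folner n) x, fam u (folner n) x)) =
          H (fam pair_value (folner n)).
  apply: ent_eq; first exact: fin_measurable_fam.
    by apply: fin_measurable_pair => //; exact: fin_measurable_fam.
  move=> x x'; split=> [/eq_fam h|[/eq_fam h1 /eq_fam h2]].
    by congr pair; apply/eq_fam => s /h[].
  by apply/eq_fam => s sF; rewrite /pair_value /value; congr pair; [exact: h1|exact: h2].
rewrite mulrDr in hn; rewrite mulrC [e * _]mulrC; lra.
Qed.

End ZeroEntropyFactor.

(** * The support map *)

Section BlockEntropy.
Context {R : realType}.

Lemma Rintegral_fin_measurable d (T : measurableType d) (P : probability T R)
    (U : finType) (X : T -> U) (f : U -> R) : fin_measurable X ->
  (\int[P]_t f (X t) = \sum_u law P X u * f u)%R.
Proof.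
move=> mX; pose h u (t : T) : \bar R := ((f u)%:E * (\1_(X @^-1` [set u]) t)%:E)%E.
have ih u : P.-integrable setT (h u).
  by apply: integrableZl => //; exact: integrable_indic.
rewrite /Rintegral (eq_integral (fun t => \sum_u h u t)%E); last first.
  move=> t _; rewrite (bigD1 (X t))//= big1 => [|u uX].
    by rewrite /h indicE mem_set// mule1 adde0.
  rewrite /h indicE memNset ?mule0//= => Xu.
  by rewrite Xu eqxx in uX.
rewrite integral_sum//.
rewrite (eq_bigr (fun u => (law P X u * f u)%:E)); first by rewrite sumEFin.
move=> u _; rewrite integralZl//; last exact: integrable_indic.
by rewrite integral_indic// setIT mulrC EFinM /law fineK// fin_num_measure.
Qed.

(** The cylinder of x is the fibre of [window F] through x, so the integrand is a function of a
    finite-valued variable. *)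
Lemma block_entropyE (A : alphabetType) (nu : probability (borel_config Zinf A) R)
    (F : {fset Zinf}) : block_entropy nu F = ent nu (window F).
Proof.
rewrite entE -(Rintegral_fin_measurable nu (fun w => ln (law nu (window F) w))
  (@fin_measurable_window A F)).
congr (- _); apply: eq_Rintegral => x _; congr (ln (fine (nu _))).
by apply/seteqP; split=> y h; [apply/eq_fam => g; exact: h|move/eq_fam: h].
Qed.

End BlockEntropy.

Section SupportMap.
Context {R : realType} {A : alphabetType}.
Variable mu : probability (borel_config Zinf A) R.
Variable p : forall g : Zinf, config (off g) A -> A -> R.
Arguments p : clear implicits.
Hypothesis hp : forall g, is_cond_prob mu (p g).
Local Notation Omega := (borel_config Zinf A).

Definition support (g : Zinf) (x : Omega) : {set A} :=
  [set a | 0 < p g (restrict_off g x) a]%SET.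

Let possible (g : Zinf) (a : A) : set (borel_config (off g) A) :=
  [set y | 0 < p g y a].
Arguments possible : clear implicits.

Let measurable_possible g a : measurable (possible g a).
Proof.
rewrite -[X in measurable X]setTI (_ : possible g a = ((p g)^~ a) @^-1` `]0, +oo[).
  exact: (hp g a).1.
by apply/seteqP; split=> y /=; rewrite /possible /= in_itv /= andbT.
Qed.

Let measurable_possible_off g a :
  measurable (restrict_off g @^-1` possible g a : set Omega).
Proof.
rewrite -[X in measurable X]setTI.
exact: (@measurable_restrict_off A g measurableT _ (@measurable_possible g a)).
Qed.

Lemma fin_measurable_support g : fin_measurable (support g).
Proof.
rewrite (_ : support g = (fun f : {ffun A -> bool} => [set a | f a]%SET) \o
  (fun x => [ffun a => `[< possible g a (restrict_off g x) >]])).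
  apply/fin_measurable_comp/fin_measurable_ffun => a.
  exact: fin_measurable_bool (@measurable_possible_off g a).
by apply/funext => x; apply/setP => a; rewrite !inE ffunE asboolb.
Qed.

(** For each letter, its membership in the support is an event off [g]; the finitely many letters
    are added one at a time. *)
Lemma approximable_support g : approximable mu g (support g).
Proof.
suff h (s : seq A) : approximable mu g (fun x => (support g x :&: [set:: s])%SET).
  apply: (approximable_determined _ _ (h (enum A))).
    exact: (fin_measurable_comp (fun S => S :&: _)%SET (@fin_measurable_support g)).
  suff -> : [set:: enum A]%SET = [set: A]%SET by move=> x x'; rewrite !finset.setIT.
  by apply/setP => a; rewrite !inE mem_enum.
elim: s => [|a s ih].
  apply: (@approximable_window _ _ _ _ _ _ fset0) => //.
    exact: (fin_measurable_comp (fun S => S :&: _)%SET (@fin_measurable_support g)).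
  by move=> x x' _; apply/setP => a; rewrite !inE !andbF.
have mI S : fin_measurable (fun x => (support g x :&: S)%SET).
  exact: (fin_measurable_comp (fun S' => S' :&: S)%SET (@fin_measurable_support g)).
have ha := approximable_restrict_off mu (@measurable_possible g a).
have mb := fin_measurable_bool (@measurable_possible_off g a).
apply: (approximable_determined _ _ (approximable_pair mb (mI _) ha ih)).
  exact: fin_measurable_pair.
move=> x x' [/= ha' /setP hs]; apply/setP => b; have := hs b; rewrite !inE.
have [->|ba] := eqVneq b a; last by [].
by move=> _; rewrite !andbT -[LHS]asboolb -[RHS]asboolb.
Qed.

End SupportMap.

Lemma support_recenter {R : realType} {A : alphabetType}
    (mu : probability (borel_config Zinf A) R)
    (p : forall g : Zinf, config (off g) A -> A -> R) r g :
  shift_invariant mu -> perm_invariant mu -> (forall h, is_cond_prob mu (p h)) ->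
  {ae mu, forall x, support p g x = support p 0 (recenter r g x)}.
Proof.
move=> mu_shift mu_perm hp.
have [N [mN N0 sN]] := cond_prob_recenter mu_shift mu_perm r (hp g) (hp 0).
exists N; split=> // x nh; apply: sN => h; apply: nh.
by apply/setP => a; rewrite !inE h.
Qed.

Theorem lemma3p4 (R : realType) (A : alphabetType) (X : set (config int A))
    (hX : subshift X)
    (mu : probability (borel_config Zinf A) R)
    (hmme : measure_of_maximal_entropy (tensor_infty X) mu)
    (hperm : perm_invariant mu)
    (phi : {mfun borel_config Zinf A >->
                 borel_config Zinf (nonempty_subset A)})
    (hphi : is_phi mu phi) :
  cvgn (entropy_seq (distribution mu phi)) /\
  entropy (distribution mu phi) = 0.
Proof.
have [mu_shift _ _] := hmme; have [p hp phiE] := hphi.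
(* Since [limn] has a default value, convergence is established along with the value of the
   limit. *)
suff cvg0 : entropy_seq (distribution mu phi) @ \oo --> (0 : R).
  by split; [apply/cvg_ex; exists 0|exact/cvg_lim].
have msup := fin_measurable_support hp.
have mphi g : fin_measurable (fun x => val (phi x g)).
  have me : fin_measurable (fun x => phi x g).
    move=> a; rewrite -[X in measurable X]setTI.
    exact: (measurable_funPT phi measurableT _ (fin_measurable_eval g a)).
  exact: (fin_measurable_comp val me).
(* Fibres under the push-forward are fibres of the composite with [phi]; [phi] agrees with the
   support map only almost everywhere, which leaves entropies unchanged. *)
have entE F : block_entropy (distribution mu phi) F = ent mu (fam (support p) F).
  rewrite block_entropyE.
  have mW : fin_measurable (window F \o phi).
    move=> w; rewrite -[X in measurable X]setTI.
    exact: (measurable_funPT phi measurableT _ (@fin_measurable_window _ F w)).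
  have -> : ent (distribution mu phi) (window F) = ent mu (window F \o phi) by [].
  transitivity (ent mu (fam (fun g x => val (phi x g)) F)).
    apply: ent_eq => //; first exact: fin_measurable_fam.
    move=> x x'; split=> /eq_fam h; apply/eq_fam => g gF; last by rewrite h.
    by apply/val_inj; exact: h.
  apply: ent_ae; try exact: fin_measurable_fam.
  have [N [mN N0 sN]] := phiE; exists N; split=> // x nh; apply: sN => h; apply: nh.
  by apply/ffunP => g; rewrite !ffunE h.
have := zero_entropy_factor mu_shift hperm msup
  (fun r g => support_recenter r g mu_shift hperm hp) (approximable_support hp 0).
rewrite (_ : (fun n => _) = entropy_seq (distribution mu phi))//.
by apply/funext => n; rewrite /entropy_seq entE.
Qed.
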